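(* Let $(E,\mathcal{E})$ be a measurable space and let $k\in\mathbb{N}$. For each $n\in\mathbb{N}_{>k}$ let $n'\in\mathbb{N}_{>k}$ (depending on $n$), let $\Omega_n\subseteq E^{n'}$, let $\mathcal{F}_n$ be the sigma-algebra on $\Omega_n$ induced by the product sigma-algebra $\mathcal{E}_{n'}$ on $E^{n'}$, and let $\nu_n$ be a probability measure on $(\Omega_n,\mathcal{F}_n)$. Let $\mathbb{P}$ be a probability measure on $(E^k,\mathcal{E}_k)$ such that $L\nu_N({}^*B)=\mathbb{P}(B)$ for any $B\in\mathcal{E}_k$ and any $N>\mathbb{N}$. Then the following are equivalent for a nonnegative measurable function $f\colon E^k\to\mathbb{R}_{\ge0}$: (1) $f$ is $\mathbb{P}$-integrable and $\lim_{n\to\infty}\int_{\Omega_n}f\,d\nu_n=\int_{E^k}f\,d\mathbb{P}$. (2) The nonstandard extension ${}^*f$ is $S$-integrable on $\Omega_N$ for all $N>\mathbb{N}$. (3) $f$ is integrable on $(\Omega_n,\nu_n)$ for all large $n\in\mathbb{N}$, and $$\lim_{m\to\infty}\lim_{n\to\infty}\int_{\Omega_n\cap\{f\ge m\}}f\,d\nu_n=0.$$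
   Context: Conventions: $\mathcal{E}_j$ is the product sigma-algebra on $E^j$; the sigma-algebra induced on $\Omega_n$ is $\{\Omega_n\cap A:A\in\mathcal{E}_{n'}\}$. For $B\in\mathcal{E}_k$, $\nu_n(B)$ denotes $\nu_n(\Omega_n\cap(B\times E^{n'-k}))$; a function $f$ on $E^k$ is regarded as a function on $\Omega_n\subseteq E^{n'}$ by composing with the projection onto the first $k$ coordinates. The same conventions apply in the nonstandard universe, so $L\nu_N({}^*B)$ is the $L\nu_N$-measure of the points of $\Omega_N$ whose first $k$ coordinates lie in ${}^*B$. Nonstandard setting: fix a sufficiently saturated (at least $\aleph_1$-saturated) nonstandard extension ${}^*$, satisfying the transfer principle, of a superstructure over a set containing $\mathbb{R}$ and copies of $E^n$ for all $n\in\mathbb{N}$. $N>\mathbb{N}$ means $N\in{}^*\mathbb{N}\setminus\mathbb{N}$. Extending the sequence $(\Omega_n,\mathcal{F}_n,\nu_n)_n$ to ${}^*\mathbb{N}$ gives an internal probability space $(\Omega_N,\mathcal{F}_N,\nu_N)$ for each $N>\mathbb{N}$. ${}^*\mathbb{R}_{\mathrm{fin}}$ is the set of $x\in{}^*\mathbb{R}$ with $|x|\le m$ for some $m\in\mathbb{N}$; for such $x$, $\operatorname{st}(x)$ is the unique real infinitely close to $x$. For an internal finitely additive probability space $(\Omega,\mathcal{F},\nu)$, the Loeb measure $L\nu$ is the completion of the unique countably additive extension of $\operatorname{st}(\nu)$ from the algebra $\mathcal{F}$ to $\sigma(\mathcal{F})$. An internal ${}^*$-integrable function $F\colon\Omega\to{}^*\mathbb{R}$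 on an internal probability space $(\Omega,\mathcal{F},\nu)$ is $S$-integrable if $L\nu(F\in{}^*\mathbb{R}_{\mathrm{fin}})=1$ and $\operatorname{st}\left({}^*\!\int_\Omega|F|\mathbb{1}_{\{|F|>M\}}\,d\nu\right)=0$ for every $M>\mathbb{N}$, where ${}^*\!\int$ is the internal integral obtained by transfer. *)

(* Defs.v *)
From HB Require Import structures.
From mathcomp Require Import all_boot all_order all_algebra.
From mathcomp Require Import all_classical all_reals all_analysis.
Set Implicit Arguments. Unset Strict Implicit. Unset Printing Implicit Defensive.
Import Order.TTheory GRing.Theory Num.Theory.
Local Open Scope classical_set_scope.
Local Open Scope ring_scope.

(** * Trace sigma-algebras *)

(* [measurableType]s are pointed in this library, so the subtype carried by A
   takes a proof that A is nonempty (automatic for a probability space). *)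
Definition sub_type (T : Type) (A : set T) (A0 : A !=set0) : Type := set_type A.

Section sub_type.
Context (T : Type) (A : set T) (A0 : A !=set0).

HB.instance Definition _ :=
  Choice.copy (sub_type A0) {classic (sub_type A0)}.
HB.instance Definition _ :=
  isPointed.Build (sub_type A0) (SigSub (mem_set (projT2 (cid A0)))).

Definition sub_val (x : sub_type A0) : T := sval x.

End sub_type.

(* The measurable sets of this type are exactly the traces on A of the
   measurable sets of T. *)
Notation trace_space A0 := (g_sigma_algebra_preimageType (@sub_val _ _ A0)).

(** * Sequences indexed by the integers greater than k *)

Definition above (k : nat) : Type := {n : nat | (k < n)%N}.

Definition above_oo (k : nat) : set_system (above k) :=
  filter_from [set: nat] (fun m => [set n : above k | (m <= sval n)%N]).

Arguments above_oo : clear implicits.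

Global Instance above_oo_filter (k : nat) : ProperFilter (above_oo k).
Proof.
apply: filter_from_proper.
  apply: filter_from_filter; first by exists 0%N.
  move=> i j _ _; exists (maxn i j) => // n /=.
  by rewrite geq_max => /andP[].
move=> m _; have h : (k < (maxn k m).+1)%N by rewrite ltnS leq_maxl.
by exists (exist (fun n => k < n)%N _ h) => /=; rewrite ltnW// ltnS leq_maxr.
Qed.

Definition proj_first (E : Type) (k m : nat) (h : (k <= m)%N)
  (x : m.-tuple E) : k.-tuple E := [tuple tnth x (widen_ord h i) | i < k].

(** * Superstructures *)

Section level.
Context (X V : Type) (elts : V -> set V) (atom : X -> V).

(* V_0(X) = X and V_(n+1)(X) = V_n(X) together with all subsets of V_n(X). *)
Fixpoint sup_level (n : nat) : set V :=
  if n is m.+1 then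
    sup_level m `|` [set s | ~ range atom s /\ elts s `<=` sup_level m]
  else range atom.

End level.

(* The superstructure over X, characterized up to isomorphism; [elts s] is the
   set of the members of s, and the value of [collect] is unspecified on
   subsets of V(X) that are not contained in any V_n(X). *)
Record superstructure (X : Type) := Superstructure {
  sup_sort :> Type;
  atom : X -> sup_sort;
  elts : sup_sort -> set sup_sort;
  collect : set sup_sort -> sup_sort;
  atom_inj : injective atom;
  elts_atom : forall x, elts (atom x) = set0;
  elts_inj : forall s t, ~ range atom s -> ~ range atom t ->
    elts s = elts t -> s = t;
  sup_levelP : forall v, exists n, sup_level elts atom n v;
  collectP : forall n (A : set sup_sort), A `<=` sup_level elts atom n ->
    ~ range atom (collect A) /\ elts (collect A) = A }.

Arguments atom {X} s : rename.
Arguments elts {X s} : rename.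
Arguments collect {X s} : rename.

Section set_operations.
Context (X : Type) (S : superstructure X).

(* Kuratowski pairs *)
Definition opair (a b : S) : S :=
  collect [set collect [set a]; collect [set a; b]].

Definition oquad (a b c d : S) : S := opair a (opair b (opair c d)).

(* The function mapping a t to b t for every t in D, as a set of pairs. *)
Definition fgraph (T : Type) (D : set T) (a b : T -> S) : S :=
  collect [set opair (a t) (b t) | t in D].

(* The value at x of the function F, [collect set0] outside its domain. *)
Definition fapp (F x : S) : S :=
  if pselect (exists y, elts F (opair x y)) is left h then sval (cid h)
  else collect set0.

End set_operations.

(** * Nonstandard extensions *)

(* Bounded formulas, with de Bruijn indices: [BAll i p] is the formula
   "for all y in x_i, p", where in p the variable 0 stands for y and the
   variable n.+1 for x_n. *)
Inductive bformula :=
| BMem of nat & nat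
| BEq of nat & nat
| BNot of bformula
| BAnd of bformula & bformula
| BAll of nat & bformula.

Fixpoint sat (X : Type) (S : superstructure X) (e : nat -> S) (p : bformula)
    : Prop :=
  match p with
  | BMem i j => elts (e j) (e i)
  | BEq i j => e i = e j
  | BNot q => ~ sat e q
  | BAnd q r => sat e q /\ sat e r
  | BAll i q => forall v, elts (e i) v ->
      sat (fun n => if n is m.+1 then e m else v) q
  end.

Record nonstandard_extension (X Y : Type)
    (S : superstructure X) (S' : superstructure Y) := NonstandardExtension {
  star :> S -> S';
  star_atoms : star (collect (range (atom S))) = collect (range (atom S'));
  transfer : forall (p : bformula) (e : nat -> S),
    sat e p <-> sat (star \o e) p }.

Definition internal (X Y : Type) (S : superstructure X) (S' : superstructure Y)
  (star : nonstandard_extension S S') (v : S') : Prop :=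
  exists A : S, elts (star A) v.

Definition aleph1_saturated (X Y : Type) (S : superstructure X)
  (S' : superstructure Y) (star : nonstandard_extension S S') : Prop :=
  forall A : nat -> S', (forall n, internal star (A n)) ->
    (forall n, exists v, forall i, (i <= n)%N -> elts (A i) v) ->
    exists v, forall i, elts (A i) v.

(* X contains R and a copy of each E^n; the copies need not be disjoint. *)
Record base_set (R : realType) (E X : Type) := BaseSet {
  real_atom : R -> X;
  point_atom : forall n : nat, n.-tuple E -> X;
  real_atom_inj : injective real_atom;
  point_atom_inj : forall n, injective (@point_atom n) }.

(** * Standard objects as elements of the superstructure *)

Section coding.
Context (R : realType) (E X : Type) (b : base_set R E X).
Context (S : superstructure X).

Definition rl (r : R) : S := atom S (real_atom b r).

Definition pt (n : nat) (x : n.-tuple E) : S := atom S (point_atom b x).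

Section space.
Context (d : measure_display) (T : measurableType d) (c : T -> X).

Definition code_set (A : set T) : S := collect ((atom S \o c) @` A).

Definition code_events : S := collect (code_set @` measurable).

Definition code_measure (P : probability T R) : S :=
  fgraph measurable code_set (fun A => rl (fine (P A))).

Definition code_fun (g : T -> R) : S := fgraph [set: T] (atom S \o c) (rl \o g).

End space.

(* The function mapping (O, F, P, g) to the integral of g, where (O, F, P) is a
   probability space whose points are atoms and g is integrable on it. *)
Definition integral_graph : S :=
  collect [set v | exists (d : measure_display) (T : measurableType d)
    (P : probability T R) (c : T -> X) (g : T -> R),
    [/\ injective c, P.-integrable [set: T] (EFin \o g) &
      v = opair (oquad (code_set c [set: T]) (code_events c) (code_measure c P)
                     (code_fun c g))
               (rl (fine (\int[P]_x (g x)%:E)))]].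

End coding.

(** * Loeb measures and S-integrability *)

Section nonstandard.
Context (R : realType) (E X : Type) (b : base_set R E X).
Context (Y : Type) (S : superstructure X) (S' : superstructure Y).
Context (star : nonstandard_extension S S').

Definition star_real (A : set R) : set S' := elts (star (collect (rl b S @` A))).

(* N is an element of *N but not of N. *)
Definition hyper_infinite (N : S') : Prop :=
  star_real (range (fun n : nat => n%:R)) N /\
  forall n : nat, N <> star (rl b S n%:R).

Definition star_finite (x : S') : Prop :=
  exists m : nat, star_real [set a | `|a| <= m%:R] x.

(* st x = r *)
Definition infinitely_close (x : S') (r : R) : Prop :=
  forall e : R, 0 < e -> star_real [set a | `|a - r| < e] x.

Definition star_op2 (h : R -> R -> R) (x y : S') : S' :=
  fapp (star (fgraph [set: R * R] (fun a => opair (rl b S a.1) (rl b S a.2))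
                   (fun a => rl b S (h a.1 a.2))))
      (opair x y).

(* |F| 1_{|F| > M} *)
Definition star_tail (Om F M : S') : S' :=
  fgraph (elts Om) id
    (fun x => star_op2 (fun a m => if m < `|a| then `|a| else 0) (fapp F x) M).

Definition on_Om (Om : S') (Om0 : elts Om !=set0) (A : set S') :
  set (sub_type Om0) := [set x | A (sub_val x)].
Arguments on_Om {Om} Om0 A.

(* sigma(F), on the set of the points of Om *)
Definition loeb_space (Om : S') (Om0 : elts Om !=set0) (F : S') : Type :=
  g_sigma_algebraType [set on_Om Om0 (elts B) | B in elts F].

(* Lnu(A) = p: A is measurable for the completion of the countably additive
   extension mu of st(nu) to sigma(F), and has measure p. *)
Definition loeb (Om F nu : S') (A : set S') (p : \bar R) : Prop :=
  exists (Om0 : elts Om !=set0)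
    (mu : {measure set (loeb_space Om0 F) -> \bar R}),
    (forall B, elts F B -> exists2 r : R, infinitely_close (fapp nu B) r &
       mu (on_Om Om0 (elts B)) = r%:E) /\
    exists C D : set (loeb_space Om0 F),
      [/\ measurable C, measurable D, C `<=` on_Om Om0 A /\ on_Om Om0 A `<=` D,
        mu (D `\` C) = 0%E & mu C = p].

(* Being in the domain of the internal integral says that (Om, F, nu) is an
   internal probability space and that G is internal and *-integrable on it. *)
Definition S_integrable (Om F nu G : S') : Prop :=
  [/\ exists y, elts (star (integral_graph b S)) (opair (oquad Om F nu G) y),
      loeb Om F nu [set x | star_finite (fapp G x)] 1%E &
      forall M, hyper_infinite M ->
        infinitely_close
          (fapp (star (integral_graph b S)) (oquad Om F nu (star_tail Om G M))) 0].

End nonstandard.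

(** * The extended sequence of probability spaces *)

Section sequence.
Context (R : realType) (d : measure_display) (E : measurableType d).
Context (X : Type) (b : base_set R E X).
Context (Y : Type) (S : superstructure X) (S' : superstructure Y).
Context (star : nonstandard_extension S S').
Context (k : nat) (n' : above k -> nat) (n'k : forall n, (k < n' n)%N).
Context (Om : forall n, set ((n' n).-tuple E)) (Om0 : forall n, Om n !=set0).
Context (nu : forall n, probability (trace_space (Om0 n)) R).

Definition first_coords (n : above k) (x : trace_space (Om0 n)) : k.-tuple E :=
  proj_first (ltnW (n'k n)) (@sub_val _ _ (Om0 n) x).

Definition nat_code (n : above k) : S := rl b S (sval n)%:R.

Definition point_code (n : above k) (x : trace_space (Om0 n)) : X :=
  point_atom b (@sub_val _ _ (Om0 n) x).

Definition star_Om (N : S') : S' :=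
  fapp (star (fgraph setT nat_code (fun n => code_set S (@point_code n) setT))) N.

Definition star_F (N : S') : S' :=
  fapp (star (fgraph setT nat_code (fun n => code_events S (@point_code n)))) N.

Definition star_nu (N : S') : S' :=
  fapp (star (fgraph setT nat_code
                (fun n => code_measure b S (@point_code n) (nu n)))) N.

(* The extension to *E^N' of the projections of E^n' onto E^k *)
Definition star_proj (N x : S') : S' :=
  fapp (star (fgraph [set: {n : above k & (n' n).-tuple E}]
               (fun q => opair (nat_code (projT1 q)) (pt b S (projT2 q)))
               (fun q => pt b S (proj_first (ltnW (n'k (projT1 q)))
                                            (projT2 q)))))
      (opair N x).

Definition star_cylinder (B : set (k.-tuple E)) (N : S') : set S' :=
  [set x | elts (star (collect (@pt R E X b S k @` B))) (star_proj N x)].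

(* *f, regarded as a function on Om_N *)
Definition star_fun (f : k.-tuple E -> R) (N : S') : S' :=
  fgraph (elts (star_Om N)) id
    (fun x => fapp (star (fgraph setT (@pt R E X b S k) (rl b S \o f)))
                  (star_proj N x)).

End sequence.

(* Main.v *)
Require Import Defs.
From HB Require Import structures.
From mathcomp Require Import all_boot all_order all_algebra.
From mathcomp Require Import all_classical all_reals all_analysis.
From mathcomp Require Import measurable_realfun lra.
Import Order.TTheory GRing.Theory Num.Theory.
Import numFieldNormedType.Exports.
Local Open Scope classical_set_scope.
Local Open Scope ring_scope.

(* By transfer, the hypothesis on the Loeb measures says that nu_n(B) --> P(B)
   for every measurable B, that is, the laws Q_n of the first k coordinates
   converge setwise to P.  Setwise convergence makes Q |-> \int g dQ lower
   semicontinuous along the sequence for g >= 0; applied to f restricted to a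
   set and to its complement, or to f and to the bounded function (m - f)^+, it
   gives (1) => (3) => (UT) => (1), where (UT) says that the f_n are eventually
   integrable and that for every e > 0 there is m with
   \int_(f > m) f dnu_n <= e for all large n.  By transfer and overspill, (UT)
   is equivalent to (2): for infinite N and M, the tail beyond M is
   infinitesimal, and f is Loeb-almost surely finite because the sets {f <= m}
   have Loeb measure P(f <= m).
   Transfer is used in the form of Los' theorem: a hyperpoint K of an index set
   extends each family u of standard objects to an internal object ext u K,
   and ext commutes with everything definable by a bounded formula. *)

(* finfun exports another fgraph. *)
Local Notation fgraph := Defs.fgraph.
#[local] Arguments sat : simpl never.

(** * Superstructures *)

Section superstructure.
Context {X : Type} {S : superstructure X}.
Implicit Types a b c d s x y z : S.

(** The extension is known only through transfer, so no ultrapower represents internal objects by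
    sequences. Hyperpoints play that role: the sets [A] with [hpt star a A K] behave like an
    ultrafilter, and passing to a finer index set turns the members of an internal set into values
    of families. Overspill takes the form of a contradiction: counterexamples at arbitrarily large
    standard indices form a sequence, whose value at an infinite hypernatural, provided by
    saturation, is an infinite index where the assumption fails. Setwise convergence gives no upper
    semicontinuity, because the mass of an unbounded f may escape to large values; small uniform
    tails supply the missing upper bound. The first clause of S-integrability is membership in the
    domain of the internal integral. Hence the integral has to be shown to depend only on the code
    of a space, and non-integrability has to be transferred as well. *)

Definition lev (n : nat) : set S := sup_level elts (atom S) n.

Lemma lev_le {m n} : (m <= n)%N -> lev m `<=` lev n.
Proof.
elim: n => [|n IH]; first by rewrite leqn0 => /eqP ->.
by rewrite leq_eqVlt ltnS => /predU1P[->//|/IH h] x /h hx; left.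
Qed.

Lemma elts_lev {n s} : lev n s -> elts s `<=` lev n.
Proof.
elim: n => [|n IH] /=; first by case=> x _ <-; rewrite elts_atom.
by case=> [/IH h|[_ h]] x /h; left.
Qed.

Lemma collect_lev n (A : set S) : A `<=` lev n -> lev n.+1 (collect A).
Proof. by move=> h; have [h1 h2] := collectP h; right; split=> //; rewrite h2. Qed.

(* [collect A] is unspecified when A is not small. *)
Definition small (A : set S) := exists n, A `<=` lev n.

Lemma elts_collect A : small A -> elts (collect A) = A.
Proof. by case=> n /collectP[]. Qed.

Lemma elts_natom s x : elts s x -> ~ range (atom S) s.
Proof. by move=> h [r _ rs]; move: h; rewrite -rs elts_atom. Qed.

(** Extensionality is available off the atoms, and a member shows that its container is not an
    atom. *)
Lemma elts_ext s (t : S) x : elts s x -> elts s = elts t -> s = t.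
Proof.
move=> h st; have h' := h; rewrite st in h'.
by apply: elts_inj => //; [exact: elts_natom h|exact: elts_natom h'].
Qed.

(** Nonemptiness matters: every atom has the same members as the empty set. *)
Lemma eq_collect s A : small A -> A !=set0 -> elts s = A <-> s = collect A.
Proof.
move=> bA [x Ax]; split=> [sA|->]; last exact: elts_collect.
by apply: (@elts_ext _ _ x); rewrite sA ?elts_collect.
Qed.

Lemma small_set2 a b : small [set a; b].
Proof.
have [[m am] [n bn]] := (sup_levelP a, sup_levelP b).
exists (maxn m n) => _ [->|->].
  by apply: lev_le am; rewrite leq_maxl.
by apply: lev_le bn; rewrite leq_maxr.
Qed.

Lemma small_set1 a : small [set a].
Proof. by have := small_set2 a a; rewrite setUid. Qed.

Lemma elts_opair a b : elts (opair a b) = [set collect [set a]; collect [set a; b]].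
Proof. exact/elts_collect/small_set2. Qed.

Lemma opair_inj {a b c d} : opair a b = opair c d -> a = c /\ b = d.
Proof.
move=> /(congr1 elts); rewrite !elts_opair => h.
have e1 x : elts (collect [set x]) = [set x] by apply/elts_collect/small_set1.
have e2 x y : elts (collect [set x; y]) = [set x; y].
  by apply/elts_collect/small_set2.
have ac : a = c.
  have : [set collect [set a]; collect [set a; b]] (collect [set c]).
    by rewrite h; left.
  case=> /(congr1 elts); rewrite ?e1 ?e2 => k.
    by have : [set a] c; [rewrite -k|].
  by have : [set c] a; [rewrite k; left|].
subst c; split => //.
have : [set collect [set a]; collect [set a; d]] (collect [set a; b]).
  by rewrite -h; right.
have : [set collect [set a]; collect [set a; b]] (collect [set a; d]).
  by rewrite h; right.
have F x y : collect [set x; y] = collect [set x] -> y = x.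
  by move=> /(congr1 elts); rewrite e1 e2 => k; have : [set x] y; [rewrite -k; right|].
have E x y z : collect [set x; y] = collect [set x; z] -> y = z.
  move=> /(congr1 elts); rewrite !e2 => k.
  have : [set x; y] z by rewrite k; right.
  have : [set x; z] y by rewrite -k; right.
  by case=> yx [] zx; congruence.
by move=> [/F da|/E//] [/F ba|/E//]; congruence.
Qed.

(** Each pair costs two levels; the explicit levels of codes below are counted this way. *)
Lemma opair_lev n a b : lev n a -> lev n b -> lev n.+2 (opair a b).
Proof.
move=> an bn; apply: collect_lev => _ [->|->]; apply: collect_lev.
  by move=> _ ->.
by move=> _ [->|->].
Qed.

(** Bounded levels are what gives a family a graph inside the superstructure, to which [star] can be
    applied. *)
Definition small_fam {T} (u : T -> S) := small (range u).

Lemma small_famP {T} (u : T -> S) :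
  small_fam u <-> exists n, forall t, lev n (u t).
Proof.
split=> -[n h]; exists n; first by move=> t; apply: h; exists t.
by move=> _ [t _ <-].
Qed.

Lemma small_comp {T U} {u : T -> S} {g : U -> T} :
  small_fam u -> small_fam (u \o g).
Proof. by move=> /small_famP[n h]; apply/small_famP; exists n => t; apply: h. Qed.

Lemma small_cst {T} s : small_fam (fun _ : T => s).
Proof. by have [n h] := sup_levelP s; apply/small_famP; exists n. Qed.

Lemma small_atom {T} (g : T -> X) : small_fam (fun t => atom S (g t)).
Proof. by apply/small_famP; exists 0%N => t; exists (g t). Qed.

Lemma small_opair {T} {u v : T -> S} : small_fam u -> small_fam v ->
  small_fam (fun t => opair (u t) (v t)).
Proof.
move=> /small_famP[m hm] /small_famP[n hn]; apply/small_famP.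
exists (maxn m n).+2 => t; apply: opair_lev.
  by apply: lev_le (hm t); rewrite leq_maxl.
by apply: lev_le (hn t); rewrite leq_maxr.
Qed.

Lemma small_collect {T} (A : T -> set S) n :
  (forall t : T, A t `<=` lev n) -> small_fam (fun t => collect (A t)).
Proof. by move=> h; apply/small_famP; exists n.+1 => t; exact: collect_lev. Qed.

Lemma small_image {T} (u : T -> S) (A : set T) :
  small_fam u -> small (u @` A).
Proof. by move=> [n h]; exists n; apply: subset_trans h => _ [t _ <-]; exists t. Qed.

Lemma elts_fgraph {T} (D : set T) (u v : T -> S) : small_fam u -> small_fam v ->
  elts (fgraph D u v) = [set opair (u t) (v t) | t in D].
Proof. by move=> bu bv; apply: elts_collect; exact/small_image/small_opair. Qed.

Lemma fappE (F x y : S) : elts F (opair x y) ->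
  (forall v, elts F (opair x v) -> v = y) -> fapp F x = y.
Proof.
move=> h u; rewrite /fapp; case: pselect => [h'|[]]; last by exists y.
by apply: u; case: cid.
Qed.

Lemma fappP (F x : S) : (exists y, elts F (opair x y)) -> elts F (opair x (fapp F x)).
Proof. by move=> h; rewrite /fapp; case: pselect => // h'; case: cid. Qed.

Lemma fgraphP {T} {D : set T} {u v : T -> S} {t s} : small_fam u -> small_fam v ->
  {in D &, injective u} -> D t -> elts (fgraph D u v) (opair (u t) s) <-> s = v t.
Proof.
move=> bu bv iu Dt; rewrite elts_fgraph//; split=> [|->]; last by exists t.
by case=> t' Dt' /opair_inj[/iu -> //]; rewrite inE.
Qed.

End superstructure.
Arguments lev {X S}.

(** * Bounded formulas for pairs and graphs *)

Section formulas.

Definition BEx i p := BNot (BAll i (BNot p)).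
Definition BOr p q := BNot (BAnd (BNot p) (BNot q)).
Definition BImp p q := BNot (BAnd p (BNot q)).
Definition BSing u x := BAnd (BMem x u) (BAll u (BEq 0 x.+1)).
Definition BDoub u x y := BAnd (BAnd (BMem x u) (BMem y u))
  (BAll u (BOr (BEq 0 x.+1) (BEq 0 y.+1))).
(** The quantifiers stay bounded because the two members of a Kuratowski pair lie in [z]; under each
    of them the indices shift by one. *)
Definition BPair z x y := BAnd (BEx z (BSing 0 x.+1))
  (BAnd (BEx z (BDoub 0 x.+1 y.+1))
    (BAll z (BOr (BSing 0 x.+1) (BDoub 0 x.+1 y.+1)))).
Definition BIn F x y := BEx F (BPair 0 x.+1 y.+1).

(** Convertible to the environment that [sat] builds at [BAll], so that [sat_all] holds by
    computation. *)
Definition scons {V} (v : V) (e : nat -> V) : nat -> V :=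
  fun n => if n is m.+1 then e m else v.


Context {X : Type} {S : superstructure X}.
Implicit Type e : nat -> S.

Lemma sat_mem e i j : sat e (BMem i j) = elts (e j) (e i).
Proof. by []. Qed.

Lemma sat_eq e i j : sat e (BEq i j) = (e i = e j).
Proof. by []. Qed.

Lemma sat_not e p : sat e (BNot p) = ~ sat e p.
Proof. by []. Qed.

Lemma sat_and e p q : sat e (BAnd p q) = (sat e p /\ sat e q).
Proof. by []. Qed.

Lemma sat_all e i p :
  sat e (BAll i p) = forall v, elts (e i) v -> sat (scons v e) p.
Proof. by []. Qed.

Lemma sat_ex e i p :
  sat e (BEx i p) = exists2 v, elts (e i) v & sat (scons v e) p.
Proof.
apply/propext; rewrite sat_not sat_all.
split=> /= [|[v ev h] k]; last by apply: k h.
by apply: contra_notP => h v ev k; apply: h; exists v.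
Qed.

Lemma sat_or e p q : sat e (BOr p q) = (sat e p \/ sat e q).
Proof. by rewrite sat_not sat_and !sat_not not_andE !notK. Qed.

Lemma sat_imp e p q : sat e (BImp p q) = (sat e p -> sat e q).
Proof. by rewrite sat_not sat_and sat_not not_andE notK implyE. Qed.

Lemma sat_sing e u x : sat e (BSing u x) = (e u = collect [set e x]).
Proof.
apply/propext; rewrite -eq_collect; [|exact: small_set1|by exists (e x)].
rewrite sat_and sat_mem sat_all; split=> [[h k]|->]; last by [].
by apply/seteqP; split=> [v /k|_ ->].
Qed.

Lemma sat_doub e u x y : sat e (BDoub u x y) = (e u = collect [set e x; e y]).
Proof.
apply/propext; rewrite -eq_collect; [|exact: small_set2|by exists (e x); left].
rewrite !sat_and !sat_mem sat_all; split=> [[[h1 h2] k]|->].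
  by apply/seteqP; split=> [v /k|_ [->|->]]//; rewrite sat_or.
by split=> [|v h]; [split; [left|right]|rewrite sat_or].
Qed.

(** Valid in every superstructure, this reads the formula on both sides of a transfer; in this way
    [star] is seen to respect Kuratowski pairs. *)
Lemma sat_pair e z x y : sat e (BPair z x y) = (e z = opair (e x) (e y)).
Proof.
apply/propext; rewrite -eq_collect; [|exact: small_set2|by eexists; left].
rewrite !sat_and !sat_ex sat_all; split.
  move=> [[u1 h1]]; rewrite sat_sing /= => E1.
  move=> [[u2 h2]]; rewrite sat_doub /= => E2 h3.
  apply/seteqP; split; last by move=> _ [->|->]; rewrite -?E1 -?E2.
  by move=> u /h3; rewrite sat_or sat_sing sat_doub.
move=> ->; split; [|split].
- by eexists; [left|rewrite sat_sing].
- by eexists; [right|rewrite sat_doub].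
- by move=> u h; rewrite sat_or sat_sing sat_doub.
Qed.

Lemma sat_in e F x y : sat e (BIn F x y) = elts (e F) (opair (e x) (e y)).
Proof.
apply/propext; rewrite sat_ex; split=> [[v h]|h]; first by rewrite sat_pair /= => <-.
by exists (opair (e x) (e y)); rewrite ?sat_pair.
Qed.

End formulas.

(** * Transfer *)

Section transfer.
Context {X Y : Type} {S : superstructure X} {S' : superstructure Y}.
Variable star : nonstandard_extension S S'.

Definition senv (l : seq S) : nat -> S := nth (collect set0) l.

Lemma transfer1 p l : sat (senv l) p -> sat (star \o senv l) p.
Proof. by move=> /(transfer star). Qed.

Lemma star_sub (A B : set S) : small A -> small B -> A `<=` B ->
  elts (star (collect A)) `<=` elts (star (collect B)).
Proof.
move=> bA bB AB.
have := @transfer1 (BAll 0 (BMem 0 2)) [:: collect A; collect B].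
rewrite !sat_all /= => h v Av; apply: h Av => w /=.
by rewrite !elts_collect// => /AB; rewrite sat_mem /= elts_collect.
Qed.

Lemma star_setU (A B : set S) v : small A -> small B ->
  elts (star (collect (A `|` B))) v ->
  elts (star (collect A)) v \/ elts (star (collect B)) v.
Proof.
move=> bA bB; have := @transfer1 (BAll 0 (BOr (BMem 0 2) (BMem 0 3)))
  [:: collect (A `|` B); collect A; collect B].
have bAB : small (A `|` B).
  have [[m Am] [n Bn]] := (bA, bB); exists (maxn m n) => x [/Am|/Bn].
    by apply: lev_le; rewrite leq_maxl.
  by apply: lev_le; rewrite leq_maxr.
rewrite !sat_all /= => h /h; rewrite sat_or !sat_mem /=; apply => w.
by rewrite sat_or !sat_mem /= !elts_collect.
Qed.

Lemma star_set1 s : elts (star (collect [set s])) = [set star s].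
Proof.
have b1 : small [set s] by exact: small_set1.
apply/seteqP; split=> [v|_ ->].
  have := @transfer1 (BAll 0 (BEq 0 2)) [:: collect [set s]; s].
  rewrite !sat_all /= => h; apply: h => w /=.
  by rewrite elts_collect// sat_eq.
have := @transfer1 (BMem 1 0) [:: collect [set s]; s].
by rewrite !sat_mem /= elts_collect//; apply.
Qed.

(** Serves to join two unrelated hyperpoints, an infinite index and an infinite threshold, into one
    over the product of their index sets. *)
Lemma star_setX (A B : set S) v w : small A -> small B ->
  elts (star (collect A)) v -> elts (star (collect B)) w ->
  elts (star (collect [set opair a b | a in A & b in B])) (opair v w).
Proof.
move=> bA bB; set C := [set _ | _ in _ & _ in _].
have bC : small C.
  have [[m Am] [n Bn]] := (bA, bB); exists (maxn m n).+2 => _ [a /Am ma] [b /Bn nb] <-.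
  apply: opair_lev; first by apply: lev_le ma; rewrite leq_maxl.
  by apply: lev_le nb; rewrite leq_maxr.
move=> Av Bw.
have : sat (star \o senv [:: collect A; collect B; collect C])
    (BAll 0 (BAll 2 (BEx 4 (BPair 0 2 1)))).
  apply: transfer1; rewrite sat_all => a /=; rewrite elts_collect// => Aa.
  rewrite sat_all => b /=; rewrite elts_collect// => Bb.
  rewrite sat_ex; exists (opair a b); last by rewrite sat_pair.
  by rewrite /= elts_collect//; exists a => //; exists b.
rewrite sat_all => /(_ _ Av); rewrite sat_all => /(_ _ Bw).
by rewrite sat_ex => -[z /= Cz]; rewrite sat_pair /= => <-.
Qed.

Section extension.
Context {T : Type}.

Definition ext (a u : T -> S) (K : S') : S' := fapp (star (fgraph [set: T] a u)) K.

(* K is a point of the nonstandard extension of the set A, coded by a. *)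
Definition hpt (a : T -> S) (A : set T) (K : S') :=
  [/\ injective a, small_fam a & elts (star (collect (a @` A))) K].

Lemma hpt_sub {a A} (B : set T) {K} : A `<=` B -> hpt a A K -> hpt a B K.
Proof.
move=> AB [ia ba AK]; split=> //; apply: star_sub AK; try exact: small_image.
exact: image_subset.
Qed.

Lemma hptT {a A K} : hpt a A K -> hpt a [set: T] K.
Proof. exact: hpt_sub. Qed.

(** The ultrafilter property of the sets whose extension contains [K]. Claims at [K] are proved by
    refuting the half on which they fail. *)
Lemma hpt_split {a A} (B : set T) {K} : hpt a A K ->
  hpt a (A `&` B) K \/ hpt a (A `\` B) K.
Proof.
move=> [ia ba]; rewrite -{1}(setUIDK A B) image_setU.
by case/star_setU; try exact: small_image; [left|right].
Qed.

Context {a : T -> S} {A : set T} {K : S'}.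

(** The second conjunct confines the value to the extension of a level, so that a bounded formula
    can quantify over it. *)
Lemma ext_graph {n} {u : T -> S} : hpt a A K -> (forall t, lev n (u t)) ->
  elts (star (fgraph [set: T] a u)) (opair K (ext a u K)) /\
  elts (star (collect (lev n))) (ext a u K).
Proof.
move=> hK un; have [ia ba AK] := hptT hK; set G := fgraph _ _ _.
have bn : @small _ S (lev n) by exists n.
have bu : small_fam u by apply/small_famP; exists n.
have bT : small (range a) by exact: small_image.
have KG : elts (star G) (opair K (ext a u K)).
  apply: fappP.
  have : sat (star \o senv [:: collect (range a); G; collect (lev n)])
      (BAll 0 (BEx 3 (BIn 3 1 0))).
    apply: transfer1; rewrite sat_all => w /=; rewrite elts_collect// => -[t _ <-].
    rewrite sat_ex; exists (u t); first by rewrite /= elts_collect.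
    by rewrite sat_in /= elts_fgraph//; exists t.
  rewrite sat_all => /(_ _ AK); rewrite sat_ex => -[y] _.
  by rewrite sat_in /=; exists y.
split=> //.
have : sat (star \o senv [:: collect (range a); G; collect (lev n)])
    (BAll 1 (BEx 1 (BEx 4 (BPair 2 1 0)))).
  apply: transfer1; rewrite sat_all => w /=; rewrite elts_fgraph// => -[t _ <-].
  rewrite sat_ex; exists (a t); first by rewrite /= elts_collect//; exists t.
  rewrite sat_ex; exists (u t); first by rewrite /= elts_collect.
  by rewrite sat_pair.
rewrite sat_all => /(_ _ KG); rewrite sat_ex => -[z] _; rewrite sat_ex => -[y ny].
by rewrite sat_pair /= => /opair_inj[_ ->].
Qed.

(** One formula is transferred: for every point of [A] and all values in a common level, if the
    graphs relate the point to the values, then [p]. Applied to [p] and to its negation it gives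
    both directions of Los' theorem. The tail [e] is arbitrary in the hypothesis and unspecified in
    the conclusion, as the formulas used read only the four families, the point (variable 4) and the
    parameter (variable 5). *)
Lemma los (p : bformula) (c : S) {u0 u1 u2 u3 : T -> S} : hpt a A K ->
  small_fam u0 -> small_fam u1 -> small_fam u2 -> small_fam u3 ->
  (forall t, A t -> forall e, sat
     (scons (u0 t) (scons (u1 t) (scons (u2 t) (scons (u3 t)
        (scons (a t) (scons c e)))))) p) ->
  exists e, sat
     (scons (ext a u0 K) (scons (ext a u1 K) (scons (ext a u2 K) (scons (ext a u3 K)
        (scons K (scons (star c) e)))))) p.
Proof.
move=> hK /small_famP[n0 b0] /small_famP[n1 b1].
move=> /small_famP[n2 b2] /small_famP[n3 b3] h.
have [n [d0 d1 d2 d3]] : exists n : nat, [/\ forall t, lev n (u0 t),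
    forall t, lev n (u1 t), forall t, lev n (u2 t) & forall t, lev n (u3 t)].
  exists (maxn (maxn n0 n1) (maxn n2 n3)).
  by split=> t; [apply: lev_le (b0 t)|apply: lev_le (b1 t)|
    apply: lev_le (b2 t)|apply: lev_le (b3 t)]; rewrite !leq_max leqnn ?orbT.
have bn : @small _ S (lev n) by exists n.
have [ia ba AK] := hK.
have bu (u : T -> S) : (forall t, lev n (u t)) -> small_fam u.
  by move=> ?; apply/small_famP; exists n.
have [[k0 l0] [k1 l1]] := (ext_graph hK d0, ext_graph hK d1).
have [[k2 l2] [k3 l3]] := (ext_graph hK d2, ext_graph hK d3).
set l := [:: c; collect (a @` A); collect (lev n); fgraph [set: T] a u0;
  fgraph [set: T] a u1; fgraph [set: T] a u2; fgraph [set: T] a u3].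
(* Variables 0 to 3 are the values, 4 the point, 5 the parameter, 6 the index set, 7 the level, and
   8 to 11 the graphs. *)
pose q := BImp (BIn 8 4 0) (BImp (BIn 9 4 1) (BImp (BIn 10 4 2)
  (BImp (BIn 11 4 3) p))).
exists (star \o senv (behead l)).
have : sat (star \o senv l) (BAll 1 (BAll 3 (BAll 4 (BAll 5 (BAll 6 q))))).
  apply: transfer1; rewrite sat_all => w /=.
  rewrite elts_collect; last exact: small_image.
  move=> [t At <-].
  rewrite sat_all => y3 _; rewrite sat_all => y2 _; rewrite sat_all => y1 _.
  rewrite sat_all => y0 _; rewrite !sat_imp !sat_in /=.
  have G u s t' : (forall t, lev n (u t)) ->
      elts (fgraph [set: T] a u) (opair (a t') s) -> s = u t'.
    by move=> /bu uu /(fgraphP ba uu); apply => //; exact: in2W.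
  move=> /(G _ _ _ d0) -> /(G _ _ _ d1) -> /(G _ _ _ d2) -> /(G _ _ _ d3) ->.
  have := h _ At (senv (behead l)); congr sat; apply/funext.
  by do 6![case=> //].
rewrite sat_all => /(_ _ AK); rewrite sat_all => /(_ _ l3).
rewrite sat_all => /(_ _ l2); rewrite sat_all => /(_ _ l1).
rewrite sat_all => /(_ _ l0); rewrite /q !sat_imp !sat_in /= => /(_ k0 k1 k2 k3).
by congr sat; apply/funext; do 6![case=> //].
Qed.

End extension.
End transfer.
Arguments hpt_sub {X Y S S' star T a A} B {K}.
Arguments hptT {X Y S S' star T a A K}.
Arguments hpt_split {X Y S S' star T a A} B {K}.

(** * Calculus of the values of families at a hyperpoint *)

Section calculus.
Context {X Y : Type} {S : superstructure X} {S' : superstructure Y}.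
Context {star : nonstandard_extension S S'}.

Section pointwise.
Context {T : Type} {a : T -> S} {A : set T} {K : S'} (hK : hpt star a A K).

Lemma ext_mem {u w : T -> S} : small_fam u -> small_fam w ->
  (forall t, A t -> elts (w t) (u t)) -> elts (ext star a w K) (ext star a u K).
Proof.
move=> bu bw uw.
have [|e] := los star (BMem 0 1) (collect set0) hK bu bw bu bu; last by rewrite sat_mem.
by move=> t /uw ? e; rewrite sat_mem.
Qed.

Lemma ext_nmem {u w : T -> S} : small_fam u -> small_fam w ->
  (forall t, A t -> ~ elts (w t) (u t)) -> ~ elts (ext star a w K) (ext star a u K).
Proof.
move=> bu bw uw.
have [|e] := los star (BNot (BMem 0 1)) (collect set0) hK bu bw bu bu.
  by move=> t /uw ? e; rewrite sat_not sat_mem.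
by rewrite sat_not sat_mem.
Qed.

Lemma ext_eq {u w : T -> S} : small_fam u -> small_fam w ->
  (forall t, A t -> u t = w t) -> ext star a u K = ext star a w K.
Proof.
move=> bu bw uw.
have [|e] := los star (BEq 0 1) (collect set0) hK bu bw bu bu; last by rewrite sat_eq.
by move=> t /uw ? e; rewrite sat_eq.
Qed.

Lemma ext_neqc {u : T -> S} {c} : small_fam u ->
  (forall t, A t -> u t <> c) -> ext star a u K <> star c.
Proof.
move=> bu uw.
have [|e] := los star (BNot (BEq 0 5)) c hK bu bu bu bu.
  by move=> t /uw ? e; rewrite sat_not sat_eq.
by rewrite sat_not sat_eq.
Qed.

Lemma ext_cst c : ext star a (fun=> c) K = star c.
Proof.
have bu : small_fam (fun _ : T => c) by exact: small_cst.
have [|e] := los star (BEq 0 5) c hK bu bu bu bu; last by rewrite sat_eq.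
by move=> t _ e; rewrite sat_eq.
Qed.

Lemma ext_id : ext star a a K = K.
Proof.
have [_ bu _] := hK.
have [|e] := los star (BEq 0 4) (collect set0) hK bu bu bu bu; last by rewrite sat_eq.
by move=> t _ e; rewrite sat_eq.
Qed.

Lemma ext_memc {u : T -> S} {c} : small_fam u ->
  (forall t, A t -> elts c (u t)) -> elts (star c) (ext star a u K).
Proof. by move=> bu h; rewrite -ext_cst; apply: ext_mem => //; exact: small_cst. Qed.

Lemma ext_nmemc {u : T -> S} {c} : small_fam u ->
  (forall t, A t -> ~ elts c (u t)) -> ~ elts (star c) (ext star a u K).
Proof. by move=> bu h; rewrite -ext_cst; apply: ext_nmem => //; exact: small_cst. Qed.

Lemma ext_opair {u w : T -> S} : small_fam u -> small_fam w ->
  ext star a (fun t => opair (u t) (w t)) K = opair (ext star a u K) (ext star a w K).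
Proof.
move=> bu bw; have bp := small_opair bu bw.
have [|e] := los star (BPair 0 1 2) (collect set0) hK bp bu bw bu; last by rewrite sat_pair.
by move=> t _ e; rewrite sat_pair.
Qed.

Lemma ext_fapp {F w y : T -> S} : small_fam F -> small_fam w -> small_fam y ->
  (forall t, A t -> elts (F t) (opair (w t) (y t))) ->
  (forall t v, A t -> elts (F t) (opair (w t) v) -> v = y t) ->
  fapp (ext star a F K) (ext star a w K) = ext star a y K.
Proof.
move=> bF bw by_ h1 h2; apply: fappE.
  by rewrite -ext_opair//; apply: ext_mem => //; exact: small_opair.
(* A value [v] of [F] is not a member of [F]; the bounded quantifiers reach it as a member of a
   member of a pair in [F]. *)
pose p := BAll 0 (BAll 0 (BAll 0 (BImp (BPair 2 4 0) (BEq 0 5)))).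
have [|e] := los star p (collect set0) hK bF bw by_ bF.
  move=> t At e; rewrite sat_all => z Fz; rewrite sat_all => s _; rewrite sat_all => v _.
  by rewrite sat_imp sat_pair sat_eq /= => zE; apply: h2 => //; rewrite -zE.
rewrite sat_all => H v Fv; move: H => /(_ _ Fv).
rewrite sat_all => /(_ (collect [set ext star a w K; v])); rewrite /= elts_opair.
move=> /(_ (or_intror erefl)); rewrite sat_all /= => /(_ v).
rewrite elts_collect; last exact: small_set2.
by move=> /(_ (or_intror erefl)); rewrite sat_imp sat_pair sat_eq; apply.
Qed.

Lemma ext_fappc {F : S} {w y : T -> S} : small_fam w -> small_fam y ->
  (forall t, A t -> elts F (opair (w t) (y t))) ->
  (forall t v, A t -> elts F (opair (w t) v) -> v = y t) ->
  fapp (star F) (ext star a w K) = ext star a y K.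
Proof.
by move=> bw by_ h1 h2; rewrite -ext_cst; apply: ext_fapp => //; exact: small_cst.
Qed.

(** Here [c] will be the graph of the integral, and being outside its domain means being
    non-integrable. *)
Lemma ext_nodom {u : T -> S} {c : S} : small_fam u ->
  (forall t y, A t -> ~ elts c (opair (u t) y)) ->
  forall y, ~ elts (star c) (opair (ext star a u K) y).
Proof.
move=> su h.
have [|e] := los star (BAll 5 (BNot (BEx 0 (BEx 0 (BPair 2 3 0))))) c hK su su su su.
  move=> t At e; rewrite sat_all => z cz; rewrite sat_not sat_ex => -[s _].
  by rewrite sat_ex => -[y _]; rewrite sat_pair /= => zE; apply: (h t y At); rewrite -zE.
rewrite sat_all => H y cy; move: H => /(_ _ cy); rewrite sat_not; apply.
rewrite sat_ex; exists (collect [set ext star a u K; y]); first by rewrite /= elts_opair; right.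
rewrite sat_ex; exists y; last by rewrite sat_pair.
by rewrite /= elts_collect; [right|exact: small_set2].
Qed.

(** The domain may vary with the index, as it does for functions and measures on the spaces
    Omega_n. *)
Lemma ext_fapp_fgraph {U : T -> Type} {D : forall t, set (U t)}
    {c v : forall t, U t -> S} {g : forall t, U t} n :
  (forall t, injective (c t)) -> (forall t x, lev n (c t x) /\ lev n (v t x)) ->
  (forall t, A t -> D t (g t)) ->
  fapp (ext star a (fun t => fgraph (D t) (c t) (v t)) K) (ext star a (fun t => c t (g t)) K)
  = ext star a (fun t => v t (g t)) K.
Proof.
move=> ic cn gD.
have sc t : small_fam (c t) by apply/small_famP; exists n => x; have [] := cn t x.
have sv t : small_fam (v t) by apply/small_famP; exists n => x; have [] := cn t x.
apply: ext_fapp.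
- apply: (@small_collect _ _ _ _ n.+2) => t _ [x _ <-].
  by have [cx vx] := cn t x; exact: opair_lev cx vx.
- by apply/small_famP; exists n => t; have [] := cn t (g t).
- by apply/small_famP; exists n => t; have [] := cn t (g t).
- by move=> t At; apply/fgraphP => //; [exact: (in2W (ic t))|exact: gD].
- by move=> t s At /fgraphP; apply => //; [exact: (in2W (ic t))|exact: gD].
Qed.

Context {T' : Type} {a' : T' -> S}.

(** Pushing a hyperpoint along [phi] amounts to precomposing families with [phi]. Thus an index
    built from a standard sequence is handled over the index set of the sequence. *)
Lemma ext_comp (u : T' -> S) (phi : T -> T') :
  injective a' -> small_fam a' -> small_fam u ->
  ext star a' u (ext star a (a' \o phi) K) = ext star a (u \o phi) K.
Proof.
move=> ia' ba' bu; rewrite /ext; apply: ext_fappc; try exact: small_comp.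
  by move=> t _; apply/fgraphP => //; exact: in2W.
by move=> t v _ /fgraphP; apply => //; exact: in2W.
Qed.

Lemma hpt_comp {B : set T'} {phi : T -> T'} : injective a' -> small_fam a' ->
  (forall t, A t -> B (phi t)) -> hpt star a' B (ext star a (a' \o phi) K).
Proof.
move=> ia' ba' AB; split => //; apply: ext_memc; first exact: small_comp.
move=> t At; rewrite elts_collect; last exact: small_image.
by exists (phi t) => //; exact: AB.
Qed.

End pointwise.

(** Splitting [K] along the preimage of [C] makes an equivalence of the two one-sided transfers of
    membership and non-membership. *)
Lemma ext_memP {T} {a : T -> S} {A K} (hK : hpt star a A K) {u : T -> S} {C : set S} :
  small_fam u -> small C ->
  elts (star (collect C)) (ext star a u K) <-> hpt star a (A `&` u @^-1` C) K.
Proof.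
move=> bu sC; split=> [Cu|h].
  case: (hpt_split (u @^-1` C) hK) => // h.
  exfalso; move: Cu; apply: (ext_nmemc h) => // t [_ /=].
  by rewrite elts_collect.
apply: (ext_memc h) => // t [_ /=]; by rewrite elts_collect.
Qed.

(** Over the empty set the hypothesis of [los] is vacuous, even for a false formula. Contradictions
    at a hyperpoint are brought to this form. *)
Lemma hpt0 {T} {a : T -> S} {K} : ~ hpt star a set0 K.
Proof.
move=> hK; have [_ ba _] := hK.
have [//|e] := los star (BNot (BEq 0 0)) (collect set0) hK ba ba ba ba.
by rewrite sat_not sat_eq.
Qed.

End calculus.

(** * Members of internal sets as selections over a finer hyperpoint *)

Section fiber.
Context {X Y : Type} {S : superstructure X} {S' : superstructure Y}.
Context {star : nonstandard_extension S S'}.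
Context {T : Type} {a : T -> S} {A : set T} {K : S'} (hK : hpt star a A K).

(* An element of an internal set in the family u at K is itself the value, at
   a point K' over K, of a selection of u. *)
Lemma ext_fiber {u : T -> S} {v : S'} : small_fam u -> elts (ext star a u K) v ->
  exists (T' : Type) (a' : T' -> S) (phi : T' -> T) (s : T' -> S) (K' : S'),
    [/\ hpt star a' [set: T'] K', small_fam s,
       forall t, A (phi t) /\ elts (u (phi t)) (s t),
       ext star a' (a \o phi) K' = K & ext star a' s K' = v].
Proof.
move=> su uv; have [ia sa _] := hK.
(* The total space of the family [u] over [A], coded by pairs; the hyperpoint above [K] is the pair
   of [K] and [v]. *)
pose T' := {p : T * S | A p.1 /\ elts (u p.1) p.2}.
pose phi (t : T') := (sval t).1; pose s (t : T') := (sval t).2.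
pose a' t := opair (a (phi t)) (s t).
have ss : small_fam s.
  have /small_famP[n un] := su; apply/small_famP; exists n => -[[t x] [/= At xu]].
  exact: elts_lev (un t) _ xu.
have sa' : small_fam a' by apply: small_opair => //; exact: small_comp.
have ia' : injective a'.
  move=> p q /opair_inj[/ia e1 e2]; apply: eq_sig_hprop => [? ? ?|]; first exact: Prop_irrelevance.
  by rewrite [LHS]surjective_pairing [RHS]surjective_pairing; congr pair.
have hK' : hpt star a' [set: T'] (opair K v).
  split => //.
  have [|e] := los star (BAll 0 (BEx 6 (BPair 0 6 1))) (collect (range a')) hK su su su su.
    move=> t At e; rewrite sat_all => x ux; rewrite sat_ex; exists (opair (a t) x).
      rewrite /= elts_collect; last exact: small_image.
      by exists (exist (fun p : T * S => A p.1 /\ elts (u p.1) p.2) (t, x) (conj At ux)).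
    by rewrite sat_pair.
  by rewrite sat_all => /(_ v uv); rewrite sat_ex => -[z /= hz]; rewrite sat_pair /= => <-.
have := ext_id hK'; rewrite (ext_opair hK' (small_comp sa) ss) => /opair_inj[E1 E2].
by exists T', a', phi, s, (opair K v); split=> // t; exact: (svalP t).
Qed.

Lemma ext_fiber_range {U : T -> Type} {c : forall t, U t -> S} {n x} :
  (forall t y, lev n (c t y)) ->
  elts (ext star a (fun t => collect (range (c t))) K) x ->
  exists (T' : Type) (a' : T' -> S) (phi : T' -> T) (s : forall t, U (phi t)) (K' : S'),
    [/\ hpt star a' [set: T'] K', forall t, A (phi t), ext star a' (a \o phi) K' = K
      & x = ext star a' (fun t => c (phi t) (s t)) K'].
Proof.
move=> cn; have On t : range (c t) `<=` lev n by move=> _ [y _ <-].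
move=> /(ext_fiber (small_collect _ _ On))[T' [a' [phi [s [K' [hK' ss h E1 E2]]]]]].
have h2 t : {y : U (phi t) | s t = c (phi t) y}.
  apply: cid; have [_] := h t; rewrite elts_collect; last by exists n.
  by case=> y _ <-; exists y.
exists T', a', phi, (fun t => sval (h2 t)), K'; split=> //; first by move=> t; case: (h t).
rewrite -E2; apply: (ext_eq hK') => //; first by apply/small_famP; exists n.
by move=> t _; exact: (svalP (h2 t)).
Qed.

(* H need only agree with w at the hyperpoints over K: this is how a graph
   defined externally in S', such as that of *f, is recognized as internal. *)
Lemma ext_fgraph {U : T -> Type} {c w : forall t, U t -> S} {n} {H : S' -> S'} :
  (forall t, U t) ->
  (forall t x, lev n (c t x)) -> (forall t x, lev n (w t x)) ->
  (forall (T' : Type) (a' : T' -> S) (phi : T' -> T) (s : forall t, U (phi t)) (K' : S'),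
     hpt star a' [set: T'] K' -> (forall t, A (phi t)) -> ext star a' (a \o phi) K' = K ->
     H (ext star a' (fun t => c (phi t) (s t)) K') =
     ext star a' (fun t => w (phi t) (s t)) K') ->
  fgraph (elts (ext star a (fun t => collect (range (c t))) K)) id H =
  ext star a (fun t => fgraph [set: U t] (c t) (w t)) K.
Proof.
move=> x0 cn wn hH; set O := fun t => _; set G := fun t => fgraph _ _ _.
have Gn t : [set opair (c t x) (w t x) | x in [set: U t]] `<=` lev n.+2.
  by move=> _ [x _ <-]; exact: opair_lev.
have On t : range (c t) `<=` lev n by move=> _ [x _ <-].
have sO : small_fam O by exact: (@small_collect _ _ _ _ n).
have sG : small_fam G by exact: (@small_collect _ _ _ _ n.+2).
have opG (T' : Type) (a' : T' -> S) (phi : T' -> T) (s : forall t, U (phi t)) K' :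
    hpt star a' [set: T'] K' -> ext star a' (a \o phi) K' = K ->
    elts (ext star a G K)
     (opair (ext star a' (fun t => c (phi t) (s t)) K')
         (ext star a' (fun t => w (phi t) (s t)) K')).
  move=> hK' E1; have [ia sa _] := hK.
  rewrite -E1 (ext_comp hK')// -(ext_opair hK'); try by apply/small_famP; exists n.
  apply: (ext_mem hK').
  - by apply: small_opair; apply/small_famP; exists n.
  - exact: small_comp.
  - by move=> t _; rewrite /= elts_collect; [exists (s t)|exists n.+2].
(* [H] is an external function, so the level of its graph is bounded through the internal sets that
   contain its arguments and its values. *)
have sH : @small _ S' [set opair x (H x) | x in elts (ext star a O K)].
  have [m Om] := sup_levelP (ext star a O K).
  have [m' Wm] := sup_levelP (star (collect (lev n))).
  exists (maxn m m').+2 => _ [x Ox <-]; apply: opair_lev.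
    by apply: (lev_le (leq_maxl m m')); exact: elts_lev Om _ Ox.
  have [T' [a' [phi [s [K' [hK' h E1 ->]]]]]] := ext_fiber_range cn Ox.
  apply: (lev_le (leq_maxr m m')); apply: elts_lev Wm _ _; rewrite hH//.
  apply: (ext_memc hK'); first by apply/small_famP; exists n.
  by move=> t _; rewrite elts_collect//; exists n.
have sub : [set opair x (H x) | x in elts (ext star a O K)] `<=` elts (ext star a G K).
  move=> _ [x Ox <-]; have [T' [a' [phi [s [K' [hK' h E1 ->]]]]]] := ext_fiber_range cn Ox.
  by rewrite hH//; exact: opG.
(* Extensionality by [elts_ext] asks for a member of the graph; the chosen points [x0] of the [U t]
   provide it. *)
have Ox0 : elts (ext star a O K) (ext star a (fun t => c t (x0 t)) K).
  apply: (ext_mem hK) => //; first by apply/small_famP; exists n.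
  by move=> t _; rewrite elts_collect; [exists (x0 t)|exists n].
apply: (@elts_ext _ _ _ _
    (opair (ext star a (fun t => c t (x0 t)) K) (H (ext star a (fun t => c t (x0 t)) K)))).
  by rewrite elts_collect//; eexists; first exact: Ox0.
rewrite elts_collect//; apply/seteqP; split=> // z /(ext_fiber sG).
move=> [T' [a' [phi [s [K' [hK' ss h E1 E2]]]]]].
have h2 t : {y : U (phi t) | s t = opair (c (phi t) y) (w (phi t) y)}.
  apply: cid; have [_] := h t; rewrite elts_collect; last by exists n.+2.
  by case=> y _ <-; exists y.
pose y t := sval (h2 t).
have small_y (r : forall t, U t -> S) : (forall t x, lev n (r t x)) ->
    small_fam (fun t => r (phi t) (y t)).
  by move=> rn; apply/small_famP; exists n.
exists (ext star a' (fun t => c (phi t) (y t)) K').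
  have [ia sa _] := hK.
  rewrite -E1 (ext_comp hK')//; apply: (ext_mem hK'); [exact: small_y|exact: small_comp|].
  by move=> t _; rewrite /= elts_collect; [exists (y t)|exists n].
rewrite hH//; last by move=> t; have [] := h t.
rewrite -(ext_opair hK'); [|exact: small_y|exact: small_y].
rewrite -E2; apply: (ext_eq hK') => //; first by apply: small_opair; exact: small_y.
by move=> t _; rewrite (svalP (h2 t)).
Qed.

End fiber.

(** * Setwise convergence of probability measures *)

Section setwise_convergence.
Context {R : realType} {d : measure_display} {T : measurableType d}.
Context {I : Type} {F : set_system I} {FF : ProperFilter F}.
Context {Q : I -> probability T R} {P : probability T R}.
Hypothesis QP : forall B, measurable B -> Q i B @[i --> F] --> P B.
Local Open Scope ereal_scope.

Import HBNNSimple.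

(** Some simple function below [g] already has [P]-integral above [c], and the integral of a simple
    function is a finite combination of measures of sets, so it converges. The integral of [g] may
    be infinite. *)
Lemma setwise_lower_semicontinuous {g : T -> \bar R} (c : \bar R) :
  measurable_fun [set: T] g -> (forall x, 0 <= g x) ->
  c < \int[P]_x g x -> \forall i \near F, c < \int[Q i]_x g x.
Proof.
move=> mg g0; rewrite ge0_integralTE// => /ereal_sup_gt[_ [h hg <-] ch].
have : sintegral (Q i) h @[i --> F] --> sintegral P h.
  rewrite (_ : sintegral _ _ = \sum_(x \in range h) x%:E * P (h @^-1` [set x]));
    last exact: sintegralE.
  rewrite (_ : (fun i => _) = fun i =>
     \sum_(x \in range h) x%:E * Q i (h @^-1` [set x])); last first.
    by apply/funext => i; exact: sintegralE.
  rewrite fsbig_finite//=.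
  under eq_fun do rewrite fsbig_finite//=.
  apply: cvg_nnesum => x _.
    by apply: nearW => i; exact: nnsfun_mulemu_ge0.
  by apply: cvgeZl => //; apply: QP.
move=> cvh; have := cvh _ (open_ereal_gt' ch).
apply: (@filterS _ F) => i; move=> /lt_le_trans; apply.
rewrite -integralT_nnsfun; apply: ge0_le_integral => //.
- by move=> x _; rewrite lee_fin.
- exact/measurable_EFinP/measurable_funP.
Qed.

Context {f : T -> R}.
Hypotheses (f0 : forall x, (0 <= f x)%R) (mf : measurable_fun [set: T] f).

Let mEf : measurable_fun [set: T] (EFin \o f).
Proof. exact/measurable_EFinP. Qed.

Let Ef0 x : 0 <= (f x)%:E. Proof. by rewrite lee_fin. Qed.

Let integral_fin (P' : probability T R) :
  P'.-integrable [set: T] (EFin \o f) <-> \int[P']_x (f x)%:E < +oo.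
Proof.
split=> [/integrableP[_]|h].
  by under eq_integral do rewrite /= ger0_norm//.
by apply/integrableP; split=> //; under eq_integral do rewrite /= ger0_norm//.
Qed.

Lemma measurable_ge (m : R) : measurable [set x | m%:E <= (f x)%:E].
Proof.
rewrite (_ : [set _ | _] = f @^-1` `[m, +oo[%classic); last first.
  by apply/seteqP; split=> x /=; rewrite in_itv/= andbT lee_fin.
by rewrite -[X in measurable X]setTI; exact: mf.
Qed.

Lemma measurable_gt (m : R) : measurable [set x | (m < f x)%R].
Proof.
rewrite (_ : [set _ | _] = f @^-1` `]m, +oo[%classic); last first.
  by apply/seteqP; split=> x /=; rewrite in_itv/= andbT.
by rewrite -[X in measurable X]setTI; exact: mf.
Qed.

Lemma cvg_integral_set A : measurable A ->
  P.-integrable [set: T] (EFin \o f) ->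
  \int[Q i]_x (f x)%:E @[i --> F] --> \int[P]_x (f x)%:E ->
  \int[Q i]_(x in A) (f x)%:E @[i --> F] --> \int[P]_(x in A) (f x)%:E.
Proof.
move=> mA Pf cf.
have mR B : measurable B -> measurable_fun [set: T] ((EFin \o f) \_ B).
  by move=> mB; apply/(measurable_restrictT _ mB); exact: measurable_funTS.
have R0 B x : 0 <= ((EFin \o f) \_ B) x by apply: erestrict_ge0 => y _; exact: Ef0.
have split_ (P' : probability T R) : \int[P']_x (f x)%:E =
    \int[P']_(x in A) (f x)%:E + \int[P']_(x in ~` A) (f x)%:E.
  by rewrite -ge0_integral_setU ?setUv//; [exact: measurableC|exact/disj_setPCl].
have fin B : measurable B -> \int[P]_(x in B) (f x)%:E \is a fin_num.
  by move=> mB; apply: integrable_fin_num => //; exact: integrableS Pf.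
have mAc := measurableC mA.
have /fineK := fin _ mA; have /fineK := fin _ mAc; have /fineK := fin _ measurableT.
move: cf; rewrite (split_ P).
set p := fine _; set q := fine _; set r := fine (\int[P]_(x in A) _).
move=> cf _ qE rE; rewrite -qE -rE -EFinD in cf; rewrite -rE.
have [finQ cfQ] := (fine_cvgP _ _).1 cf.
have lsc B s (e : R) : measurable B -> \int[P]_(x in B) (f x)%:E = s%:E -> (0 < e)%R ->
    \forall i \near F, (s - e)%:E < \int[Q i]_(x in B) (f x)%:E.
  move=> mB sE e0; have := @setwise_lower_semicontinuous _ (s - e)%:E (mR _ mB) (R0 B).
  rewrite -integral_mkcond sE lte_fin gtrBl => /(_ e0).
  by apply: filterS => i; rewrite -integral_mkcond.
have both : \forall i \near F, \int[Q i]_(x in A) (f x)%:E \is a fin_num /\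
    \int[Q i]_(x in ~` A) (f x)%:E \is a fin_num.
  apply: filterS finQ => i; rewrite split_ fin_numD => /andP[]//.
apply/fine_cvgP; split; first by apply: filterS both => i [].
apply/cvgrPdist_lt => e e0; have e20 : (0 < e / 2)%R by rewrite divr_gt0.
move/cvgrPdist_lt : cfQ => /(_ _ e20) cfQ.
near=> i; have [finA finAc] : \int[Q i]_(x in A) (f x)%:E \is a fin_num /\
    \int[Q i]_(x in ~` A) (f x)%:E \is a fin_num by near: i.
have : (r - e)%:E < \int[Q i]_(x in A) (f x)%:E by near: i; exact: lsc.
(* The upper bound on [A] is the total, known up to e/2, minus this lower bound on the complement,
   known up to e/2. *)
have : (q - e / 2)%:E < \int[Q i]_(x in ~` A) (f x)%:E by near: i; exact: lsc.
have : (`|r + q - fine (\int[Q i]_x (f x)%:E)| < e / 2)%R by near: i.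
rewrite split_ fineD//= -(fineK finA) -(fineK finAc) !lte_fin /=.
move=> /ltr_normlP[]; rewrite ltr_norml; lra.
Unshelve. all: by end_near. Qed.

(** Dominated convergence under [f] itself: as [f] is real-valued, each point leaves the sets {f >=
    m} eventually. *)
Lemma cvg_integral_tail : P.-integrable [set: T] (EFin \o f) ->
  (fun m : nat => \int[P]_(x in [set x | m%:R%:E <= (f x)%:E]) (f x)%:E) @ \oo --> 0.
Proof.
move=> Pf.
rewrite (_ : (fun m => _) = (fun m : nat =>
    \int[P]_x ((EFin \o f) \_ [set x | m%:R%:E <= (f x)%:E]) x)); last first.
  by apply/funext => m; rewrite integral_mkcond.
rewrite -(integral0 P [set: T]).
have mR (m : nat) : measurable_fun [set: T]
    ((EFin \o f) \_ [set x | m%:R%:E <= (f x)%:E]).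
  by apply/(measurable_restrictT _ (measurable_ge _)); exact: measurable_funTS.
have [//|||//|] := @dominated_convergence _ _ _ P [set: T] measurableT
  (fun m : nat => (EFin \o f) \_ [set x | m%:R%:E <= (f x)%:E])
  (cst 0) (EFin \o f) mR.
- apply: aeW => x _; apply: cvg_near_cst; near=> m.
  rewrite patchE ifF//; apply/negP; rewrite inE/= lee_fin; apply/negP; rewrite -ltNge.
  by near: m; exact: nbhs_infty_gtr.
- exact: Pf.
- apply: aeW => x m _; rewrite patchE; case: ifP => _; last by rewrite abse0; have := Ef0 x.
  by rewrite /= ger0_norm ?f0.
- by [].
Unshelve. all: by end_near. Qed.

(** The strict inequality is that of [star_tail]; [tail_le_ge] compares it with the weak one in
    (3). *)
Definition tail (P' : probability T R) (m : nat) : \bar R :=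
  \int[P']_(x in [set x | (m%:R < f x)%R]) (f x)%:E.

Lemma tail_le_ge P' (m : nat) :
  tail P' m <= \int[P']_(x in [set x | m%:R%:E <= (f x)%:E]) (f x)%:E.
Proof.
apply: ge0_subset_integral => //; [exact: measurable_gt|exact: measurable_ge| |].
  exact: measurable_funTS.
by move=> x /= /ltW; rewrite lee_fin.
Qed.

Lemma tail_antitone P' (m n : nat) : (m <= n)%N -> tail P' n <= tail P' m.
Proof.
move=> mn; apply: ge0_subset_integral => //; try exact: measurable_gt.
  exact: measurable_funTS.
by move=> x /=; apply: le_lt_trans; rewrite ler_nat.
Qed.

(** Pointwise, max(m, f) is at most m plus f restricted to {f > m}. This turns a bound on the tail
    into a bound on the integral of [f]. *)
Lemma integral_max_le (P' : probability T R) (m : nat) :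
  \int[P']_x (Num.max m%:R (f x))%:E <= m%:R%:E + tail P' m.
Proof.
have -> : m%:R%:E + tail P' m =
    \int[P']_x (m%:R%:E + ((EFin \o f) \_ [set x | (m%:R < f x)%R]) x).
  rewrite ge0_integralD//=.
  - by rewrite integral_cst//= probability_setT mule1 -integral_mkcond.
  - by move=> x _; apply: erestrict_ge0 => y _ /=.
  - by apply/(measurable_restrictT _ (measurable_gt _)); exact: measurable_funTS.
apply: ge0_le_integral => //=.
- by move=> x _; rewrite lee_fin le_max f0 orbT.
- by apply/measurable_EFinP; apply: measurable_maxr.
- apply: emeasurable_funD => //.
  by apply/(measurable_restrictT _ (measurable_gt _)); exact: measurable_funTS.
- move=> x _; rewrite patchE; case: ifPn; rewrite ?inE/= ?notin_setE/=.
    by move=> /ltW mf'; rewrite max_r// -EFinD lee_fin lerDr.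
  by move=> /negP; rewrite -leNgt => fm; rewrite max_l// adde0.
Qed.

Definition uniform_tails := forall e : R, (0 < e)%R -> exists m : nat,
  \forall i \near F, tail (Q i) m <= e%:E.

Lemma uniform_tailsP : uniform_tails -> P.-integrable [set: T] (EFin \o f) /\
  \int[Q i]_x (f x)%:E @[i --> F] --> \int[P]_x (f x)%:E.
Proof.
move=> ut.
have le_max_f (P' : probability T R) (m : nat) :
    \int[P']_x (f x)%:E <= m%:R%:E + tail P' m.
  apply: le_trans (integral_max_le P' m); apply: ge0_le_integral => //=.
  - by apply/measurable_EFinP; apply: measurable_maxr.
  - by move=> x _; rewrite lee_fin le_max lexx orbT.
(* Were the integral above [m + 1], lower semicontinuity would push some integral under [Q i] above
   [m + 1], where a tail of at most 1 does not let it go. *)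
have Pf : \int[P]_x (f x)%:E < +oo.
  have [m um] := ut 1%R ltr01.
  rewrite (@le_lt_trans _ _ (m%:R + 1)%:E) ?ltry// leNgt; apply/negP => h.
  have [i [+ h2]] := filter_ex (filterI (setwise_lower_semicontinuous _ mEf Ef0 h) um).
  apply/negP; rewrite -leNgt; by apply: le_trans (le_max_f _ m) _; rewrite EFinD leeD2l.
split; first exact/integral_fin.
have PfE : \int[P]_x (f x)%:E \is a fin_num.
  by rewrite ge0_fin_numE//; exact: integral_ge0.
have [p pE] : exists p, \int[P]_x (f x)%:E = p%:E.
  by exists (fine (\int[P]_x (f x)%:E)); rewrite fineK.
have up (e : R) : (0 < e)%R -> \forall i \near F, \int[Q i]_x (f x)%:E < (p + e)%:E.
  move=> e0; have e20 : (0 < e / 2)%R by rewrite divr_gt0.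
  have [m um] := ut _ e20.
  (* Since f + g = max(m, f), the two integrals add up to at least m under [P] and to at most m +
     e/2 under [Q i]. A lower bound for [g] under [Q i] is therefore an upper bound for [f]. *)
  pose g x : R := Num.max (m%:R - f x)%R 0%R.
  have g0 x : 0 <= (g x)%:E by rewrite lee_fin le_max lexx orbT.
  have mg : measurable_fun [set: T] (EFin \o g).
    by apply/measurable_EFinP; apply: measurable_maxr => //; exact: measurable_funB.
  have sum_fg (P' : probability T R) : \int[P']_x (f x)%:E + \int[P']_x (g x)%:E =
      \int[P']_x (Num.max m%:R (f x))%:E.
    rewrite -ge0_integralD//; apply: eq_integral => x _.
    rewrite -EFinD /g; congr EFin; case: (leP m%:R%R (f x)) => h.
      by rewrite max_r ?subr_le0// addr0.
    by rewrite max_l ?subr_ge0 ?ltW// addrC subrK.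
  have gm : \int[P]_x (g x)%:E <= m%:R%:E.
    rewrite -[leRHS]mule1 -(@probability_setT _ _ _ P) -integral_cst//.
    apply: ge0_le_integral => //= x _; rewrite lee_fin /g ge_max ler0n andbT.
    by rewrite gerBl.
  have [q qE] : exists q, \int[P]_x (g x)%:E = q%:E.
    exists (fine (\int[P]_x (g x)%:E)); rewrite fineK// ge0_fin_numE ?integral_ge0//.
    exact: le_lt_trans gm (ltry _).
  have mpq : (m%:R <= p + q)%R.
    rewrite -lee_fin EFinD -pE -qE sum_fg -[leLHS]mule1 -(@probability_setT _ _ _ P).
    rewrite -integral_cst//; apply: ge0_le_integral => //=.
    - by apply/measurable_EFinP; apply: measurable_maxr.
    - by move=> x _; rewrite lee_fin le_max lexx.
  have : (q - e / 2)%:E < \int[P]_x (g x)%:E by rewrite qE lte_fin gtrBl.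
  move=> /(setwise_lower_semicontinuous _ mg g0); apply: filterS2 um => i um gq.
  have := integral_max_le (Q i) m; rewrite -sum_fg => /le_trans.
  move=> /(_ _ (leeD2l _ um)); have := gq.
  have := @integral_ge0 _ _ _ (Q i) [set: T] (EFin \o f) (fun x _ => Ef0 x).
  rewrite /=; case: (\int[Q i]_x (f x)%:E) => [A||]; case: (\int[Q i]_x (g x)%:E) => [B||]//.
  by rewrite -!EFinD !lee_fin !lte_fin; lra.
rewrite pE; apply/fine_cvgP; split.
  apply: filterS (up _ ltr01) => i h; rewrite ge0_fin_numE ?integral_ge0//.
  exact: lt_trans h (ltry _).
apply/cvgrPdist_lt => e e0; have : (p - e)%:E < \int[P]_x (f x)%:E.
  by rewrite pE lte_fin gtrBl.
move=> /(setwise_lower_semicontinuous _ mEf Ef0); apply: filterS2 (up _ e0) => i.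
have := @integral_ge0 _ _ _ (Q i) [set: T] (EFin \o f) (fun x _ => Ef0 x).
rewrite /=; case: (\int[Q i]_x (f x)%:E) => [A||]//.
by rewrite !lte_fin/= ltr_norml; lra.
Qed.

Lemma near_integrable : \int[Q i]_x (f x)%:E @[i --> F] --> \int[P]_x (f x)%:E ->
  P.-integrable [set: T] (EFin \o f) ->
  \forall i \near F, (Q i).-integrable [set: T] (EFin \o f).
Proof.
move=> cf /integral_fin Pf.
have := cf _ (open_ereal_lt' Pf); apply: (@filterS _ F) => i h; exact/integral_fin.
Qed.

Lemma uniform_tailsI (l : nat -> \bar R) :
  (forall m : nat, \int[Q i]_(x in [set x | m%:R%:E <= (f x)%:E]) (f x)%:E @[i --> F]
     --> l m) -> l @ \oo --> 0 -> uniform_tails.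
Proof.
move=> Ql l0 e e0; have e0' : 0 < e%:E by rewrite lte_fin.
have [m _ /(_ m (leqnn m)) lm] := l0 _ (open_ereal_lt' e0'); exists m.
have := Ql m _ (open_ereal_lt' lm); apply: (@filterS _ F) => i /ltW.
exact: le_trans (tail_le_ge _ _).
Qed.

End setwise_convergence.
Arguments tail {R d T} f P' m.
Arguments uniform_tails {R d T I} F Q f.

(** * Codes of probability spaces *)

Section codes.
Context {R : realType} {E X : Type} {b : base_set R E X} {S : superstructure X}.

Lemma rl_inj : injective (rl b S).
Proof. by move=> x y /(@atom_inj _ S)/real_atom_inj. Qed.

Lemma pt_inj n : injective (@pt R E X b S n).
Proof. by move=> x y /(@atom_inj _ S)/point_atom_inj. Qed.

Lemma lev_atom n (x : X) : lev n (atom S x).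
Proof. by apply: (lev_le (leq0n n)); exists x. Qed.

Section space.
Context {d : measure_display} {T : measurableType d} {c : T -> X}.
Hypothesis ic : injective c.

Let icS : injective (atom S \o c).
Proof. by move=> x y /(@atom_inj _ S) /ic. Qed.

Lemma elts_code_set A : elts (code_set S c A) = (atom S \o c) @` A.
Proof. by apply: elts_collect; exists 0%N => _ [x _ <-]; exists (c x). Qed.

Lemma code_set_inj : injective (code_set S c).
Proof.
move=> A B /(congr1 elts); rewrite !elts_code_set => AB.
have sub C D : (atom S \o c) @` C = (atom S \o c) @` D -> C `<=` D.
  move=> CD x Cx; have : ((atom S \o c) @` D) (atom S (c x)) by rewrite -CD; exists x.
  by case=> y Dy /icS <-.
by apply/seteqP; split; exact: sub.
Qed.

Lemma code_set_lev A : lev 1 (code_set S c A).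
Proof. by apply: collect_lev => _ [x _ <-]; exists (c x). Qed.

Lemma elts_code_events : elts (code_events S c) = code_set S c @` measurable.
Proof. by apply: elts_collect; exists 1%N => _ [x _ <-]; exact: code_set_lev. Qed.

Lemma code_events_lev : lev 2 (code_events S c).
Proof. by apply: collect_lev => _ [x _ <-]; exact: code_set_lev. Qed.

Lemma elts_code_measure (P : probability T R) : elts (code_measure b S c P) =
  [set opair (code_set S c A) (rl b S (fine (P A))) | A in measurable].
Proof.
apply: elts_fgraph; apply/small_famP; exists 1%N => A; first exact: code_set_lev.
exact: lev_atom.
Qed.

Lemma code_measure_lev (P : probability T R) : lev 4 (code_measure b S c P).
Proof.
apply: collect_lev => _ [A _ <-].
apply: opair_lev; [exact: code_set_lev|exact: lev_atom].
Qed.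

Lemma elts_code_fun (g : T -> R) : elts (code_fun b S c g) =
  [set opair (atom S (c x)) (rl b S (g x)) | x in [set: T]].
Proof. by apply: elts_fgraph; exact: small_atom. Qed.

Lemma code_fun_lev (g : T -> R) : lev 3 (code_fun b S c g).
Proof. by apply: collect_lev => _ [A _ <-]; apply: opair_lev; exact: lev_atom. Qed.

End space.

Definition code_space {d} {T : measurableType d} (c : T -> X) (P : probability T R)
  (g : T -> R) : S :=
  oquad (code_set S c [set: T]) (code_events S c) (code_measure b S c P) (code_fun b S c g).

Lemma code_space_lev {d} {T : measurableType d} (c : T -> X) P g :
  lev 10 (code_space c P g).
Proof.
(* All four components lie in level 4, and the three nested pairs of [oquad] add two levels each. *)
have C : lev 4 (code_set S c [set: T]) := lev_le (isT : (1 <= 4)%N) _ (code_set_lev _).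
have D : lev 4 (code_events S c) := lev_le (isT : (2 <= 4)%N) _ code_events_lev.
have F : lev 4 (code_fun b S c g) := lev_le (isT : (3 <= 4)%N) _ (code_fun_lev _).
apply: opair_lev; first exact: lev_le C.
apply: opair_lev; first exact: lev_le D.
by apply: opair_lev F; exact: code_measure_lev.
Qed.

Lemma elts_integral_graph v : elts (integral_graph b S) v <->
  exists (d : measure_display) (T : measurableType d)
    (P : probability T R) (c : T -> X) (g : T -> R),
    [/\ injective c, P.-integrable [set: T] (EFin \o g) &
      v = opair (code_space c P g) (rl b S (fine (\int[P]_x (g x)%:E)))].
Proof.
rewrite elts_collect//; exists 12%N => _ [d [T [P [c [g [_ _ ->]]]]]].
by apply: opair_lev; [exact: code_space_lev|exact: lev_atom].
Qed.

(* Two spaces with the same code are isomorphic, so that the integral depends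
   only on the code. *)
Lemma code_space_integral {d1 d2} {T1 : measurableType d1} {T2 : measurableType d2}
  {c1 : T1 -> X} {c2 : T2 -> X} {P1 : probability T1 R} {P2 : probability T2 R}
  {g1 : T1 -> R} {g2 : T2 -> R} :
  injective c1 -> injective c2 -> code_space c1 P1 g1 = code_space c2 P2 g2 ->
  P1.-integrable [set: T1] (EFin \o g1) ->
  P2.-integrable [set: T2] (EFin \o g2) /\
  (\int[P2]_x (g2 x)%:E = \int[P1]_x (g1 x)%:E)%E.
Proof.
move=> i1 i2 /opair_inj[eT /opair_inj[eE /opair_inj[eP eg]]] int1.
(* Equality of the codes of the point sets gives a bijection [phi]; the codes of the events, the
   measure and the function then make it an isomorphism carrying [g1] to [g2]. *)
have h x : {y | c2 y = c1 x}.
  apply: cid; have : elts (code_set S c1 [set: T1]) (atom S (c1 x)).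
    by rewrite elts_code_set; exists x.
  by rewrite eT elts_code_set => -[y _ /(@atom_inj _ S)]; exists y.
pose phi x := sval (h x); have phiE x : c2 (phi x) = c1 x := svalP (h x).
have phi_surj y : exists x, phi x = y.
  have : elts (code_set S c2 [set: T2]) (atom S (c2 y)).
    by rewrite elts_code_set; exists y.
  rewrite -eT elts_code_set => -[x _ /(@atom_inj _ S)]; rewrite -phiE => /i2; by exists x.
have codeE A : code_set S c2 A = code_set S c1 (phi @^-1` A).
  rewrite /code_set; congr collect; apply/seteqP; split=> [_ [y Ay <-]|_ [x Ax <-]].
    by have [x xy] := phi_surj y; exists x; rewrite /= ?xy// -phiE xy.
  by exists (phi x) => //=; rewrite phiE.
have mphi A : measurable A -> measurable (phi @^-1` A).
  move=> mA; have : elts (code_events S c2) (code_set S c2 A).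
    by rewrite elts_code_events; exists A.
  by rewrite -eE elts_code_events codeE => -[B mB /(code_set_inj i1) <-].
have mphi2 A : measurable (phi @^-1` A) -> measurable A.
  move=> mA; have : elts (code_events S c1) (code_set S c1 (phi @^-1` A)).
    by rewrite elts_code_events; exists (phi @^-1` A).
  by rewrite eE elts_code_events -codeE => -[B mB /(code_set_inj i2) <-].
have gE x : g2 (phi x) = g1 x.
  have : elts (code_fun b S c1 g1) (opair (atom S (c1 x)) (rl b S (g1 x))).
    by rewrite elts_code_fun; exists x.
  rewrite eg elts_code_fun => -[y _ /opair_inj[/(@atom_inj _ S) + /rl_inj <-]].
  by rewrite -phiE => /i2 ->.
have PE A : measurable A -> P2 A = P1 (phi @^-1` A).
  move=> mA.
  have : elts (code_measure b S c2 P2) (opair (code_set S c2 A) (rl b S (fine (P2 A)))).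
    by rewrite elts_code_measure; exists A.
  rewrite -eP elts_code_measure codeE => -[B mB /opair_inj[/(code_set_inj i1) BE /rl_inj e]].
  by rewrite -[LHS]fineK ?fin_num_measure// -e BE fineK// fin_num_measure//; exact: mphi.
have mphi_fun : measurable_fun [set: T1] phi.
  by move=> _ A mA; rewrite setTI; exact: mphi.
have mg2 : measurable_fun [set: T2] (EFin \o g2).
  move=> _ A mA; rewrite setTI; apply: mphi2.
  have /integrableP[m1 _] := int1; have := m1 measurableT A mA.
  by rewrite setTI; congr measurable; apply/seteqP; split=> x /=; rewrite gE.
have g2phi : (EFin \o g2) \o phi = EFin \o g1 by apply/funext => x /=; rewrite gE.
have int2 : (pushforward P1 phi).-integrable [set: T2] (EFin \o g2).
  by apply: integrable_pushforward => //; rewrite preimage_setT g2phi.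
have eqP A : measurable A -> A `<=` [set: T2] -> P2 A = pushforward P1 phi A.
  by move=> mA _; exact: PE.
have intE (f : T2 -> \bar R) : (\int[P2]_x f x = \int[pushforward P1 phi]_x f x)%E.
  exact: eq_measure_integral.
split.
  by have /integrableP[m2 fin2] := int2; apply/integrableP; rewrite intE.
by rewrite intE integral_pushforward// ?preimage_setT ?g2phi.
Qed.

(** As the integral depends only on the code, the graph is that of a function, and the space at hand
    may replace the one hidden in the existential quantifiers. *)
Lemma integral_graphP {d} {T : measurableType d} {c : T -> X} {P : probability T R}
  {g : T -> R} v : injective c ->
  elts (integral_graph b S) (opair (code_space c P g) v) <->
  P.-integrable [set: T] (EFin \o g) /\ v = rl b S (fine (\int[P]_x (g x)%:E)).
Proof.
move=> ic; split=> [/elts_integral_graph|[intg ->]]; last first.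
  by apply/elts_integral_graph; exists d, T, P, c, g.
move=> [d1 [T1 [P1 [c1 [g1 [ic1 int1 /opair_inj[e ->]]]]]]].
by have [int eint] := code_space_integral ic1 ic (esym e) int1; rewrite eint.
Qed.

End codes.

(** * Infinite hypernaturals *)

Section hyper.
Context {R : realType} {E X Y : Type} {b : base_set R E X}.
Context {S : superstructure X} {S' : superstructure Y}.
Context {star : nonstandard_extension S S'}.

Lemma ext_memiff {T : Type} {a : T -> S} {A K} (hK : hpt star a A K) {u w : T -> S} :
  small_fam u -> small_fam w ->
  elts (ext star a w K) (ext star a u K) <->
  hpt star a (A `&` [set t | elts (w t) (u t)]) K.
Proof.
move=> su sw; split=> [h|h]; last by apply: (ext_mem h) => // t [].
case: (hpt_split [set t | elts (w t) (u t)] hK) => // h'.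
by exfalso; move: h; apply: (ext_nmem h') => // t [].
Qed.

Lemma hptI {T : Type} {a : T -> S} {A B K} :
  hpt star a A K -> hpt star a B K -> hpt star a (A `&` B) K.
Proof.
move=> hA hB; have [ia sa KB] := hB; case: (hpt_split B hA) => // h.
exfalso; have : elts (star (collect (a @` B))) (ext star a a K) by rewrite (ext_id hA).
apply: (ext_nmemc h) => // t [_ Bt].
by rewrite elts_collect; [case=> s Bs /ia st; apply: Bt; rewrite -st|exact: small_image].
Qed.

Lemma small_rl T (g : T -> R) : small_fam (fun t => rl b S (g t)).
Proof. exact: small_atom. Qed.

Lemma star_realE (A : set R) x : star_real b star A x <-> hpt star (rl b S) A x.
Proof.
split=> [h|[]//]; split=> //; [exact: rl_inj|exact: (small_rl _ id)].
Qed.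

(** [infinitely_close] unfolds to such memberships, so this is the passage by which estimates at
    standard indices reach a hyperpoint, and back. *)
Lemma star_real_ext {T} {a : T -> S} {A K} (B : set R) (g : T -> R) :
  hpt star a A K ->
  star_real b star B (ext star a (fun t => rl b S (g t)) K) <->
  hpt star a (A `&` g @^-1` B) K.
Proof.
move=> hK; rewrite /star_real (ext_memP hK (small_rl _ g)); last first.
  exact/small_image/(small_rl _ id).
rewrite (_ : _ @^-1` _ = g @^-1` B)//; apply/seteqP; split=> t /=.
  by case=> r Br /rl_inj <-.
by exists (g t).
Qed.

Lemma infinitely_close_uniq x r s :
  infinitely_close b star x r -> infinitely_close b star x s -> r = s.
Proof.
move=> xr xs; apply/eqP/negPn/negP => rs.
have e0 : 0 < `|r - s| / 2 by rewrite divr_gt0// normr_gt0 subr_eq0.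
have := hptI ((star_realE _ _).1 (xr _ e0)) ((star_realE _ _).1 (xs _ e0)).
rewrite (_ : _ `&` _ = set0); first exact: hpt0.
apply/seteqP; split=> // t [/= h1 h2].
have := ler_distD t r s; rewrite (distrC r t) leNgt => /negP; apply.
by rewrite [ltRHS]splitr ltrD.
Qed.

Definition nat_atom (n : nat) : S := rl b S n%:R.

Lemma nat_atom_inj : injective nat_atom.
Proof. by move=> m n /rl_inj /eqP; rewrite eqr_nat => /eqP. Qed.

Lemma small_nat_atom {T} (g : T -> nat) : small_fam (fun t => nat_atom (g t)).
Proof. exact: small_atom. Qed.

Lemma hyper_infiniteP N : hyper_infinite b star N <->
  hpt star nat_atom [set: nat] N /\ forall n, N <> star (nat_atom n).
Proof.
rewrite /hyper_infinite /star_real image_comp.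
split=> [[h1 h2]|[[_ _ h1] h2]]; split=> //.
by split; [exact: nat_atom_inj|exact: (small_nat_atom id)|].
Qed.

(** By induction, the standard values are split off one at a time: the extension of a singleton
    contains nothing but the standard number. *)
Lemma hyper_infinite_ge {N} (m : nat) : hyper_infinite b star N ->
  hpt star nat_atom [set j | (m <= j)%N] N.
Proof.
move=> /hyper_infiniteP[hN Nn]; elim: m => [|m IH]; first exact: hpt_sub hN.
case: (hpt_split [set m] IH); last first.
  apply: hpt_sub => j [/= mj jm]; rewrite ltn_neqAle mj andbT eq_sym.
  exact/eqP.
rewrite setIidr; last by move=> _ -> /=.
by move=> [_ _]; rewrite image_set1 star_set1 => /Nn[].
Qed.

Lemma hyper_infinite_comp {T} {a : T -> S} {K} (u : T -> nat) :
  (forall n : nat, hpt star a [set t | (n <= u t)%N] K) ->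
  hyper_infinite b star (ext star a (nat_atom \o u) K).
Proof.
move=> hK; apply/hyper_infiniteP; split.
  apply: (hpt_comp (hK 0%N)) => //; [exact: nat_atom_inj|exact: (small_nat_atom id)].
move=> n; apply: (ext_neqc (hK n.+1)); first exact: small_nat_atom.
by move=> t /= nu /nat_atom_inj ut; rewrite ut ltnn in nu.
Qed.

(** Saturation is applied to the extensions of the final segments of the integers; [n] itself lies
    in all those that start at or before [n]. *)
Lemma hyper_infinite_exists : aleph1_saturated star -> exists K, hyper_infinite b star K.
Proof.
move=> sat_star; pose A n := collect (nat_atom @` [set j | (n <= j)%N]).
have sA n : small (nat_atom @` [set j | (n <= j)%N]).
  by apply: small_image; exact: (small_nat_atom id).
have [||K hK] := sat_star (star \o A).
- by move=> n; exists (collect [set A n]); rewrite star_set1.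
- move=> n; exists (star (nat_atom n)) => i ni.
  have := @transfer1 _ _ _ _ star (BMem 0 1) [:: nat_atom n; A i].
  by rewrite !sat_mem /=; apply; rewrite elts_collect//; exists n.
have hK' n : hpt star nat_atom [set j | (n <= j)%N] K.
  by split; [exact: nat_atom_inj|exact: (small_nat_atom id)|exact: hK].
exists K; apply/hyper_infiniteP; split; first exact: hptT (hK' 0%N).
move=> n; rewrite -[K](ext_id (hK' n.+1)); apply: (ext_neqc (hK' n.+1)).
  exact: (small_nat_atom id).
by move=> t /= nt /nat_atom_inj ut; rewrite ut ltnn in nt.
Qed.

End hyper.

(** * The internal spaces *)

Section internal_space.
Context {R : realType} {d : measure_display} {E : measurableType d}.
Context {X Y : Type} {b : base_set R E X}.
Context {S : superstructure X} {S' : superstructure Y}.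
Context {star : nonstandard_extension S S'}.
Context {k : nat} {n' : above k -> nat} {n'k : forall n, (k < n' n)%N}.
Context {Om : forall n, set ((n' n).-tuple E)} {Om0 : forall n, Om n !=set0}.
Context {nu : forall n, probability (trace_space (Om0 n)) R}.

Local Notation idx := (nat_code b S (k:=k)).
Local Notation pc := (fun n => @point_code R d E X b k n' Om Om0 n).
Local Notation fc := (fun n => @first_coords d E k n' n'k Om Om0 n).

Lemma idx_inj : injective idx.
Proof.
move=> m n /rl_inj /eqP; rewrite eqr_nat => /eqP mn.
by apply: eq_sig_hprop => // j; exact: bool_irrelevance.
Qed.

Lemma small_idx {T} (g : T -> above k) : small_fam (fun t => idx (g t)).
Proof. exact: small_atom. Qed.

Lemma point_code_inj n : injective (pc n).
Proof. by move=> x y /point_atom_inj; rewrite /sub_val => /eq_sig_hprop; apply. Qed.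

Lemma measurable_first_coords n : measurable_fun [set: trace_space (Om0 n)] (fc n).
Proof.
have mval : measurable_fun [set: trace_space (Om0 n)] (@sub_val _ _ (Om0 n)).
  by move=> _ B mB; exists B.
apply: measurableT_comp => //; apply/measurable_fun_tnthP => i.
rewrite (_ : _ \o _ = (@tnth _ E ^~ (widen_ord (ltnW (n'k n)) i))).
  exact: measurable_tnth.
by apply/funext => x; rewrite /= tnth_mktuple.
Qed.

Lemma hyper_infinite_idx {N} (m : nat) : hyper_infinite b star N ->
  hpt star idx [set n | (m <= sval n)%N] N.
Proof.
move=> hN; split; [exact: idx_inj|exact: (small_idx id)|].
(* The bound [k.+1] ensures that the numbers kept are indices in [above k]. *)
have [_ sa sn] := hyper_infinite_ge (maxn m k.+1) hN.
apply: star_sub sn; [exact: small_image|exact/small_image/(small_idx id)|].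
move=> w [j /=]; rewrite geq_max => /andP[mj kj] <-.
by exists (exist (fun n => (k < n)%N) j kj).
Qed.

Lemma hyper_infinite_idxT {N} : hyper_infinite b star N -> hpt star idx [set: above k] N.
Proof. by move=> /(hyper_infinite_idx 0)/hptT. Qed.

Definition events_of (A : forall n, set (trace_space (Om0 n))) (n : above k) : S :=
  code_set S (pc n) (A n).

Lemma small_events_of A {T} (g : T -> above k) : small_fam (fun t => events_of A (g t)).
Proof. by apply/small_famP; exists 1%N => t; exact: code_set_lev. Qed.

Lemma Om_fiber {T} {a : T -> S} {A K x} {nn : T -> above k} :
  hpt star a A K -> elts (star_Om b star Om0 (ext star a (idx \o nn) K)) x ->
  exists (T' : Type) (a' : T' -> S) (phi : T' -> T)
      (s : forall t, trace_space (Om0 (nn (phi t)))) (K' : S'),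
    [/\ hpt star a' [set: T'] K', forall t, A (phi t), ext star a' (a \o phi) K' = K
      & x = ext star a' (fun t => atom S (pc _ (s t))) K'].
Proof.
move=> hK; rewrite /star_Om -/(ext star idx (events_of (fun n => setT)) _).
rewrite (ext_comp hK) //; [|exact: idx_inj|exact: (small_idx id)|exact: (small_events_of _ id)].
by move=> /(@ext_fiber_range _ _ _ _ _ _ _ _ _ hK
  (fun t => trace_space (Om0 (nn t))) (fun t y => atom S (pc _ y)) 0%N);
  apply=> t y; exact: lev_atom.
Qed.

Lemma star_proj_ext {T} {a : T -> S} {A K} {nn : T -> above k}
    (s : forall t, trace_space (Om0 (nn t))) :
  hpt star a A K ->
  star_proj b star n'k (ext star a (idx \o nn) K) (ext star a (fun t => atom S (pc _ (s t))) K)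
  = ext star a (fun t => pt b S (fc _ (s t))) K.
Proof.
move=> hK; rewrite /star_proj.
(* [star_proj] extends a single function on the disjoint union of the E^n'; the pair of index and
   point is the image of [K] in that union. *)
pose T2 := {n : above k & (n' n).-tuple E}.
pose a2 (q : T2) := opair (idx (projT1 q)) (pt b S (projT2 q)).
pose phi t : T2 := existT _ (nn t) (@sub_val _ _ (Om0 (nn t)) (s t)).
have -> : opair (ext star a (idx \o nn) K) (ext star a (fun t => atom S (pc _ (s t))) K)
    = ext star a (a2 \o phi) K.
  by rewrite -(ext_opair hK) //; [exact: small_idx|exact: small_atom].
rewrite -/(ext star a2 _ _) (ext_comp hK)//.
- move=> [n x] [m y] /opair_inj[/idx_inj /= nm]; subst m.
  by move=> /pt_inj ->.
- by apply: small_opair; [exact: small_idx|exact: small_atom].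
- exact: small_atom.
Qed.

Lemma star_cylinder_ext {T} {a : T -> S} {A K} {nn : T -> above k} B
    (s : forall t, trace_space (Om0 (nn t))) :
  hpt star a A K ->
  star_cylinder b star n'k B (ext star a (idx \o nn) K)
     (ext star a (fun t => atom S (pc _ (s t))) K) <->
  hpt star a (A `&` [set t | B (fc _ (s t))]) K.
Proof.
move=> hK; rewrite /star_cylinder /= (star_proj_ext _ hK) (ext_memP hK).
- rewrite (_ : _ @^-1` _ = [set t | B (fc _ (s t))])//; apply/seteqP; split=> t /=.
    by case=> x Bx /pt_inj <-.
  by exists (fc _ (s t)).
- exact: small_atom.
- by apply: small_image; exact: small_atom.
Qed.

(** The Loeb hypothesis speaks of a preimage under the extended projection, whereas [star_nu]
    measures internal events. On Omega_N the two descriptions of a cylinder agree. *)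
Lemma elts_cylinder {N B x} : hyper_infinite b star N -> elts (star_Om b star Om0 N) x ->
  elts (ext star idx (events_of (fun n => fc n @^-1` B)) N) x <->
  star_cylinder b star n'k B N x.
Proof.
move=> /hyper_infinite_idxT hN; rewrite -{1}(ext_id hN).
move=> /(Om_fiber hN)[T' [a' [phi [s [K' [hK' _ E1 ->]]]]]].
rewrite -E1 (star_cylinder_ext _ _ hK') (ext_comp hK').
rewrite (ext_memiff hK').
- rewrite (_ : [set t | elts _ _] = [set t | B (fc _ (s t))])//.
  apply/seteqP; split=> t /=; rewrite elts_code_set.
    by case=> y By /(@atom_inj _ S)/point_code_inj <-.
  by move=> Bs; exists (s t).
- exact: small_atom.
- exact: (small_events_of _ phi).
- exact: idx_inj.
- exact: (small_idx id).
- exact: (small_events_of _ id).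
Qed.

Lemma code_events_of {N A} : hyper_infinite b star N -> (forall n, measurable (A n)) ->
  elts (star_F b star Om0 N) (ext star idx (events_of A) N).
Proof.
move=> /hyper_infinite_idxT hN mA; apply: (ext_mem hN).
- exact: (small_events_of _ id).
- by apply/small_famP; exists 2%N => t; exact: code_events_lev.
- by move=> n _; rewrite elts_code_events; exists (A n).
Qed.

Lemma star_nu_events_of {N A} : hyper_infinite b star N -> (forall n, measurable (A n)) ->
  fapp (star_nu b star nu N) (ext star idx (events_of A) N) =
  ext star idx (fun n => rl b S (fine (nu n (A n)))) N.
Proof.
move=> /hyper_infinite_idxT hN mA.
apply: (@ext_fapp_fgraph _ _ _ _ _ _ _ _ _ hN (fun n => set (trace_space (Om0 n)))
  (fun n => measurable) (fun n => code_set S (pc n)) (fun n B => rl b S (fine (nu n B))) A 1%N).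
- by move=> n; apply: code_set_inj; exact: point_code_inj.
- by move=> n B; split; [exact: code_set_lev|exact: lev_atom].
- by move=> n _; exact: mA.
Qed.

(** [star_fun] is a graph formed outside the internal universe; as a value of a family of standard
    codes it becomes a legitimate argument of the internal integral. *)
Lemma star_fun_ext {N} (f : k.-tuple E -> R) : hyper_infinite b star N ->
  star_fun b star n'k Om0 f N =
  ext star idx (fun n => code_fun b S (pc n) (f \o fc n)) N.
Proof.
move=> /hyper_infinite_idxT hN; rewrite /star_fun.
apply: (@ext_fgraph _ _ _ _ _ _ _ _ _ hN (fun n => trace_space (Om0 n))
  (fun n x => atom S (pc n x)) (fun n x => rl b S (f (fc n x))) 0%N).
- by move=> n; exact: point.
- by move=> n x; exact: lev_atom.
- by move=> n x; exact: lev_atom.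
move=> T' a' phi s K' hK' _ E1; rewrite -E1 (star_proj_ext _ hK').
rewrite -/(ext star (@pt R E X b S k) _ _).
rewrite (@ext_comp _ _ _ _ _ _ _ _ _ hK' _ (@pt R E X b S k) _ (fun t => fc _ (s t)))//.
- exact: pt_inj.
- exact: small_atom.
- exact: small_atom.
Qed.

Lemma star_fun_fapp {T} {a : T -> S} {A K} {nn : T -> above k} (f : k.-tuple E -> R)
    (s : forall t, trace_space (Om0 (nn t))) :
  hpt star a A K -> hyper_infinite b star (ext star a (idx \o nn) K) ->
  fapp (star_fun b star n'k Om0 f (ext star a (idx \o nn) K))
    (ext star a (fun t => atom S (pc _ (s t))) K) =
  ext star a (fun t => rl b S (f (fc _ (s t)))) K.
Proof.
move=> hK hN; rewrite (star_fun_ext _ hN) (ext_comp hK).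
- apply: (@ext_fapp_fgraph _ _ _ _ _ _ _ _ _ hK (fun t => trace_space (Om0 (nn t)))
    (fun n => setT) (fun t x => atom S (pc _ x)) (fun t x => rl b S (f (fc _ x))) s 0%N).
  + by move=> t x y /(@atom_inj _ S)/point_code_inj.
  + by move=> t x; split; exact: lev_atom.
  + by [].
- exact: idx_inj.
- exact: (small_idx id).
- by apply/small_famP; exists 3%N => t; exact: code_fun_lev.
Qed.

End internal_space.

(** * Internal integrals of extended functions and of their truncations *)

Section internal_integrals.
Context {R : realType} {d : measure_display} {E : measurableType d}.
Context {X Y : Type} {b : base_set R E X}.
Context {S : superstructure X} {S' : superstructure Y}.
Context {star : nonstandard_extension S S'}.
Context {k : nat} {n' : above k -> nat} {n'k : forall n, (k < n' n)%N}.
Context {Om : forall n, set ((n' n).-tuple E)} {Om0 : forall n, Om n !=set0}.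
Context {nu : forall n, probability (trace_space (Om0 n)) R}.

Local Notation idx := (nat_code b S (k:=k)).
Local Notation natc := (@nat_atom R E X b S).
Local Notation pc := (fun n => @point_code R d E X b k n' Om Om0 n).
Local Notation fc := (fun n => @first_coords d E k n' n'k Om Om0 n).

Section hyperpoint.
Context {T : Type} {a : T -> S} {A : set T} {K : S'} (hK : hpt star a A K).
Context {nn : T -> above k}.
Local Notation N := (ext star a (idx \o nn) K).

Definition space_code (g : forall t, trace_space (Om0 (nn t)) -> R) (t : T) : S :=
  code_space (b := b) (S := S) (pc (nn t)) (nu (nn t)) (g t).

Lemma small_space_code g : small_fam (space_code g).
Proof. by apply/small_famP; exists 10%N => t; exact: code_space_lev. Qed.

Lemma space_code_ext (g : forall t, trace_space (Om0 (nn t)) -> R) :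
  oquad (star_Om b star Om0 N) (star_F b star Om0 N) (star_nu b star nu N)
    (ext star a (fun t => code_fun b S (pc (nn t)) (g t)) K) =
  ext star a (space_code g) K.
Proof.
have iidx := @idx_inj R d E X b S k.
have sidx : small_fam idx by exact: (small_idx id).
have s1 : small_fam (fun n => code_set S (pc n) [set: trace_space (Om0 n)]).
  by apply/small_famP; exists 1%N => n; exact: code_set_lev.
have s2 : small_fam (fun n => code_events S (pc n)).
  by apply/small_famP; exists 2%N => n; exact: code_events_lev.
have s3 : small_fam (fun n => code_measure b S (pc n) (nu n)).
  by apply/small_famP; exists 4%N => n; exact: code_measure_lev.
have s4 : small_fam (fun t => code_fun b S (pc (nn t)) (g t)).
  by apply/small_famP; exists 3%N => t; exact: code_fun_lev.
rewrite /space_code /code_space /oquad.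
have c3 := small_opair (small_comp (g := nn) s3) s4.
have c2 := small_opair (small_comp (g := nn) s2) c3.
rewrite (ext_opair hK (small_comp (g := nn) s1) c2).
rewrite (ext_opair hK (small_comp (g := nn) s2) c3) (ext_opair hK (small_comp (g := nn) s3) s4).
have H u (su : small_fam u) : ext star idx u N = ext star a (u \o nn) K.
  exact: (ext_comp hK).
by rewrite -(H _ s1) -(H _ s2) -(H _ s3).
Qed.

(** Membership in the graph answers the first clause of S-integrability, and the value of the
    integral enters the third. *)
Lemma star_integral (g : forall t, trace_space (Om0 (nn t)) -> R) :
  (forall t, A t -> (nu (nn t)).-integrable setT (EFin \o g t)) ->
  elts (star (integral_graph b S)) (opair (ext star a (space_code g) K)
     (ext star a (fun t => rl b S (fine (\int[nu (nn t)]_x (g t x)%:E))) K)) /\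
  fapp (star (integral_graph b S)) (ext star a (space_code g) K) =
     ext star a (fun t => rl b S (fine (\int[nu (nn t)]_x (g t x)%:E))) K.
Proof.
move=> ig; have sg := small_space_code g.
have sr : small_fam (fun t => rl b S (fine (\int[nu (nn t)]_x (g t x)%:E))).
  exact: small_rl.
split.
  rewrite -(ext_opair hK sg sr); apply: (ext_memc hK (small_opair sg sr)) => t At.
  by apply/integral_graphP; [exact: point_code_inj|split=> //; exact: ig].
apply: (ext_fappc hK sg sr) => [t At|t v At].
  by apply/integral_graphP; [exact: point_code_inj|split=> //; exact: ig].
by move=> /(integral_graphP _ (@point_code_inj _ _ _ _ _ _ _ _ _ _))[].
Qed.

(** Allows eventual integrability to be deduced from (2), whose first clause would fail at an
    infinite index reached through non-integrable functions. *)
Lemma star_nonintegrable (g : forall t, trace_space (Om0 (nn t)) -> R) y :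
  (forall t, A t -> ~ (nu (nn t)).-integrable setT (EFin \o g t)) ->
  ~ elts (star (integral_graph b S)) (opair (ext star a (space_code g) K) y).
Proof.
move=> ng; apply: (ext_nodom hK (small_space_code g)) => t v At.
by move=> /(integral_graphP _ (@point_code_inj _ _ _ _ _ _ _ _ _ _))[/ng]; exact.
Qed.

Context {mm : T -> nat}.

Definition tail_fun (f : k.-tuple E -> R) (n : above k) (m : nat)
    (x : trace_space (Om0 n)) : R :=
  if m%:R < `|f (fc n x)| then `|f (fc n x)| else 0.

(** Index and threshold are both families over the hyperpoint, so they may be independent, as in
    (UT) => (2), or tied together by a sequence, as in the converse. *)
Lemma star_tail_ext (f : k.-tuple E -> R) : hyper_infinite b star N ->
  star_tail b star (star_Om b star Om0 N) (star_fun b star n'k Om0 f N)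
    (ext star a (natc \o mm) K) =
  ext star a (fun t => code_fun b S (pc (nn t)) (tail_fun f (nn t) (mm t))) K.
Proof.
move=> hN; rewrite /star_tail.
have iidx := @idx_inj R d E X b S k.
have sidx : small_fam idx by exact: (small_idx id).
have -> : star_Om b star Om0 N = ext star a (fun t => collect
    (range (fun x : trace_space (Om0 (nn t)) => atom S (pc (nn t) x)))) K.
  rewrite /star_Om -/(ext star idx (events_of (fun n => setT)) _) (ext_comp hK)//.
  exact: (small_events_of _ id).
apply: (@ext_fgraph _ _ _ _ _ _ _ _ _ hK (fun t => trace_space (Om0 (nn t)))
  (fun t x => atom S (pc (nn t) x))
  (fun t x => rl b S (tail_fun f (nn t) (mm t) x)) 0%N).
- by move=> t; exact: point.
- by move=> t x; exact: lev_atom.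
- by move=> t x; exact: lev_atom.
move=> T' a' phi s K' hK' _ E1; have [ia sa _] := hK.
have EN : N = ext star a' (idx \o (nn \o phi)) K'.
  by rewrite -E1 (ext_comp hK')//; exact: small_idx.
have EM : ext star a (natc \o mm) K = ext star a' (natc \o (mm \o phi)) K'.
  by rewrite -E1 (ext_comp hK')//; exact: small_nat_atom.
rewrite EN EM in hN *; rewrite (star_fun_fapp _ _ hK' hN) /star_op2.
set s1 := fun t => rl b S (f (fc _ (s t))).
rewrite -(ext_opair hK' (small_rl _ _) (small_nat_atom _)).
pose a2 (r : R * R) := opair (rl b S r.1) (rl b S r.2).
rewrite -/(ext star a2 _ _).
rewrite (@ext_comp _ _ _ _ _ _ _ _ _ hK' _ a2 _ (fun t => (f (fc _ (s t)), (mm (phi t))%:R)))//.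
- by move=> [x y] [x' y'] /opair_inj[/rl_inj /= -> /rl_inj ->].
- by apply: small_opair; exact: small_rl.
- exact: small_rl.
Qed.

End hyperpoint.

End internal_integrals.

(** * Eventual properties of indices *)

Section above.
Context {k : nat}.

Lemma near_aboveP (A : set (above k)) :
  (\forall n \near above_oo k, A n) <-> exists m : nat, forall n : above k, (m <= sval n)%N -> A n.
Proof. by split=> [[m _ h]|[m h]]; exists m. Qed.

(** Since [j] bounds [g j] from below, the value of the sequence of counterexamples at an infinite
    hypernatural is an infinite index; [m] keeps it in a range where other properties hold. *)
Lemma not_near_above (A : set (above k)) (m : nat) : ~ (\forall n \near above_oo k, A n) ->
  exists g : nat -> above k, forall j, (maxn m j <= sval (g j))%N /\ ~ A (g j).
Proof.
move=> nA; have h j : {n : above k | (maxn m j <= sval n)%N /\ ~ A n}.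
  apply: cid; apply: contra_notP nA => h; apply/near_aboveP; exists (maxn m j) => n mn.
  by apply: contra_notP h => nAn; exists n.
by exists (fun j => sval (h j)) => j; exact: (svalP (h j)).
Qed.

End above.

(** * Loeb measures of cylinders and setwise convergence *)

Section loeb_measure.
Context {R : realType} {d : measure_display} {E : measurableType d}.
Context {X Y : Type} {b : base_set R E X}.
Context {S : superstructure X} {S' : superstructure Y}.
Context {star : nonstandard_extension S S'}.
Hypothesis sat_star : aleph1_saturated star.
Context {k : nat} {n' : above k -> nat} {n'k : forall n, (k < n' n)%N}.
Context {Om : forall n, set ((n' n).-tuple E)} {Om0 : forall n, Om n !=set0}.
Context {nu : forall n, probability (trace_space (Om0 n)) R}.
Context {P : probability (k.-tuple E) R}.
Hypothesis nuP : forall (B : set (k.-tuple E)) (N : S'),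
       measurable B -> hyper_infinite b star N ->
       loeb b star (star_Om b star Om0 N) (star_F b star Om0 N)
         (star_nu b star nu N) (star_cylinder b star n'k B N) (P B).

Local Notation idx := (nat_code b S (k:=k)).
Local Notation natc := (@nat_atom R E X b S).
Local Notation onOm ne0 := (@on_Om Y S' _ ne0).
Local Notation ev := (events_of (b:=b) (S:=S)).
Local Notation pc := (fun n => @point_code R d E X b k n' Om Om0 n).
Local Notation fc := (fun n => @first_coords d E k n' n'k Om Om0 n).

Lemma measurable_cylinder n B : measurable B -> measurable (fc n @^-1` B).
Proof. by move=> mB; rewrite -[X in measurable X]setTI; exact: measurable_first_coords. Qed.

Lemma hyper_infinite_sub {K} (g : nat -> above k) : hyper_infinite b star K ->
  (forall j, (j <= sval (g j))%N) -> hyper_infinite b star (ext star natc (idx \o g) K).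
Proof.
move=> hK gj; apply: (hyper_infinite_comp (fun j => sval (g j))) => n.
by apply: hpt_sub (hyper_infinite_ge n hK) => j /leq_trans; apply.
Qed.

Lemma on_Om_cylinder {N} (B : set (k.-tuple E)) (ne0 : elts (star_Om b star Om0 N) !=set0) :
  hyper_infinite b star N ->
  onOm ne0 (elts (ext star idx (ev (fun n => fc n @^-1` B)) N)) =
  onOm ne0 (star_cylinder b star n'k B N).
Proof.
move=> hN; apply/seteqP; split=> -[x Ox]; have Ox' : elts (star_Om b star Om0 N) x;
  by [move: Ox; rewrite inE|have [h1 h2] := elts_cylinder (n'k := n'k) (B := B) hN Ox'].
Qed.

(** Indices where nu_n(B) stays at distance at least [e] from P(B) would yield an infinite N with
    the same property, although the Loeb measure of the cylinder, the standard part of nu_N, is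
    P(B). *)
Lemma cvg_cylinder B : measurable B ->
  nu n (fc n @^-1` B) @[n --> above_oo k] --> P B.
Proof.
move=> mB; have mc n := measurable_cylinder n _ mB.
rewrite -(@fineK _ (P B)) ?fin_num_measure//; apply/fine_cvgP; split.
  by apply: nearW => n; rewrite fin_num_measure.
apply/cvgrPdist_lt => e e0; apply: contrapT => /(not_near_above _ 0)[g gP].
have [K hK] := hyper_infinite_exists (b := b) sat_star.
have [hK' _] := (hyper_infiniteP _).1 hK.
have hN : hyper_infinite b star (ext star natc (idx \o g) K).
  by apply: hyper_infinite_sub => // j; have [] := gP j; rewrite max0n.
have [ne0 [mu [Hmu [C [D [mC mD [CA AD] muDC muC]]]]]] := nuP _ _ mB hN.
have Bin := code_events_of hN mc.
have [r rclose mur] := Hmu _ Bin.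
(* The cylinder is an internal event squeezed between [C] and [D]. These have equal measure [P B],
   so [mu] takes this value on it. *)
have rE : r%:E = P B.
  rewrite -mur on_Om_cylinder//.
  have mA : measurable (onOm ne0 (star_cylinder b star n'k B (ext star natc (idx \o g) K))
      : set (loeb_space ne0 (star_F b star Om0 (ext star natc (idx \o g) K)))).
    by apply: sub_sigma_algebra; eexists; [exact: Bin|exact: on_Om_cylinder].
  apply/eqP; rewrite eq_le -muC; apply/andP; split; last by apply: le_measure; rewrite ?inE.
  rewrite (@le_trans _ _ (mu D))//; first by apply: le_measure; rewrite ?inE.
  have CD : C `<=` D by exact: subset_trans AD.
  have mDC := measurableD mD mC.
  rewrite -(setDUK CD) measureU//; last first.
    by apply/seteqP; split=> // x [Cx [_]]; apply.
  by move: muDC => /= ->; rewrite adde0.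
move: (rclose _ e0); rewrite (star_nu_events_of hN mc).
rewrite (ext_comp hK'); [|exact: idx_inj|exact: (small_idx id)|exact: small_rl].
rewrite (star_real_ext [set t | `|t - r| < e] (fun j => fine (nu (g j) (fc (g j) @^-1` B))) hK').
rewrite (_ : _ `&` _ = set0); first exact: hpt0.
apply/seteqP; split=> // j [_ /=] h; have [_] := gP j; apply.
by rewrite -rE /= distrC.
Qed.

Section function.
Context {f : k.-tuple E -> R}.
Hypotheses (f_ge0 : forall x, 0 <= f x) (f_meas : measurable_fun [set: k.-tuple E] f).

Let mcyl (m : nat) : measurable [set x | f x <= m%:R].
Proof.
rewrite (_ : [set _ | _] = f @^-1` `]-oo, m%:R]%classic).
  by rewrite -[X in measurable X]setTI; exact: f_meas.
by apply/seteqP; split=> x /=; rewrite in_itv.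
Qed.

Lemma star_real_star_fun {N x} (m : nat) :
  hyper_infinite b star N -> elts (star_Om b star Om0 N) x ->
  star_real b star [set a | `|a| <= m%:R] (fapp (star_fun b star n'k Om0 f N) x) <->
  star_cylinder b star n'k [set x | f x <= m%:R] N x.
Proof.
move=> hN; have hN' : hpt star idx [set: above k] N := hyper_infinite_idxT hN.
rewrite -{1}(ext_id hN').
move=> /(Om_fiber hN')[T' [a' [phi [s [K' [hK' _ E1 ->]]]]]].
rewrite -E1 in hN *; rewrite (star_fun_fapp _ _ hK' hN) (star_cylinder_ext _ _ hK').
rewrite (star_real_ext _ (fun t => f (fc _ (s t))) hK').
rewrite (_ : _ @^-1` _ = [set t | f (fc _ (s t)) <= m%:R])//.
by apply/seteqP; split=> t /=; rewrite ger0_norm.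
Qed.

Lemma loeb_finite N : hyper_infinite b star N ->
  loeb b star (star_Om b star Om0 N) (star_F b star Om0 N) (star_nu b star nu N)
    [set x | star_finite b star (fapp (star_fun b star n'k Om0 f N) x)] 1%E.
Proof.
(* The hypothesis, taken at the whole space, supplies the countably additive extension [mu]
   itself. *)
move=> hN; have [ne0 [mu [Hmu _]]] := nuP _ _ measurableT hN.
exists ne0, mu; split => //.
pose A m := onOm ne0 (star_cylinder b star n'k [set x | f x <= m%:R] N)
  : set (loeb_space ne0 (star_F b star Om0 N)).
have AE m : A m = onOm ne0 (elts (ext star idx
    (ev (fun n => fc n @^-1` [set x | f x <= m%:R])) N)).
  by rewrite on_Om_cylinder.
have Bin m := code_events_of hN (fun n => measurable_cylinder n _ (mcyl m)).
have mA m : measurable (A m).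
  by apply: sub_sigma_algebra; eexists; [exact: Bin|exact: on_Om_cylinder].
have ndA : nondecreasing_seq A.
  move=> m n mn; apply/subsetPset => -[x Ox] /=.
  have Ox' : elts (star_Om b star Om0 N) x by move: Ox; rewrite inE.
  rewrite /A /on_Om /= /sub_val/= -!(star_real_star_fun _ hN)//.
  rewrite !star_realE; apply: hpt_sub => r /= /le_trans; apply.
  by rewrite ler_nat.
(* Setwise convergence puts P(f <= m) infinitely close to nu_N of the internal event, and standard
   parts are unique. *)
have muA m : mu (A m) = P [set x | f x <= m%:R].
  have [r rclose mur] := Hmu _ (Bin m); rewrite AE mur.
  rewrite -[RHS]fineK ?fin_num_measure//; congr EFin.
  apply: infinitely_close_uniq rclose _.
  rewrite (star_nu_events_of hN); last by move=> n; exact: measurable_cylinder.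
  move=> e e0; have /fine_cvgP[_ /cvgrPdist_lt/(_ _ e0)/near_aboveP[j hj]] :
      nu n (fc n @^-1` [set x | f x <= m%:R]) @[n --> above_oo k] -->
      (fine (P [set x | f x <= m%:R]))%:E.
    by rewrite fineK ?fin_num_measure//; exact: cvg_cylinder.
  have hj' : hpt star idx [set n | (j <= sval n)%N] N := hyper_infinite_idx j hN.
  apply/(star_real_ext _ (fun n => fine (nu n (fc n @^-1` [set x | f x <= m%:R]))) hj').
  by apply: hpt_sub hj' => n jn; split=> //=; rewrite distrC; exact: hj.
(* Finiteness is defined by a countable union of internal conditions; the set therefore lies in the
   generated sigma-algebra and serves as its own inner and outer approximation. *)
have capE : onOm ne0 [set x | star_finite b star (fapp (star_fun b star n'k Om0 f N) x)]
    = \bigcup_m A m.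
  apply/seteqP; split=> -[x Ox].
    have Ox' : elts (star_Om b star Om0 N) x by move: Ox; rewrite inE.
    by move=> [m /(star_real_star_fun _ hN Ox') h]; exists m.
  have Ox' : elts (star_Om b star Om0 N) x by move: Ox; rewrite inE.
  by move=> [m _ /(star_real_star_fun _ hN Ox') h]; exists m.
have mU : measurable (\bigcup_m A m) by exact: bigcupT_measurable.
exists (\bigcup_m A m), (\bigcup_m A m); split => //.
- by split; rewrite capE.
- by rewrite setDv measure0.
have h1 := nondecreasing_cvg_mu mA mU ndA.
have h2 : P [set x | f x <= m%:R] @[m --> \oo] --> P (\bigcup_(m : nat) [set x | f x <= m%:R]).
  apply: nondecreasing_cvg_mu; [exact: mcyl|exact: bigcupT_measurable|].
  move=> m n mn; apply/subsetPset => x /= /le_trans; apply.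
  by rewrite ler_nat.
have -> : 1%E = P (\bigcup_(m : nat) [set x | f x <= m%:R]).
  rewrite -(@probability_setT _ _ _ P); congr (P _); apply/seteqP; split=> // x _.
  by exists (Num.truncn (f x)).+1 => //=; apply: ltW; exact: truncnS_gt.
have h3 : P [set x | f x <= m%:R] @[m --> \oo] --> mu (\bigcup_m A m).
  have muAE : mu \o A = (fun m : nat => P [set x | f x <= m%:R]).
    by apply/funext => m; exact: muA.
  rewrite -muAE; exact: h1.
by apply: (cvg_unique _ h3 h2).
Qed.

End function.
End loeb_measure.

(** * Laws of the first k coordinates *)

Section law.
Context {R : realType} {d : measure_display} {E : measurableType d}.
Context {k : nat} {n' : above k -> nat} {n'k : forall n, (k < n' n)%N}.
Context {Om : forall n, set ((n' n).-tuple E)} {Om0 : forall n, Om n !=set0}.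
Context {nu : forall n, probability (trace_space (Om0 n)) R}.

Local Notation fc := (fun n => @first_coords d E k n' n'k Om Om0 n).

HB.instance Definition _ n := isMeasurableFun.Build _ _ _ _
  (@first_coords d E k n' n'k Om Om0 n) (measurable_first_coords n).

Definition law n : probability (k.-tuple E) R :=
  distribution (nu n) (@first_coords d E k n' n'k Om Om0 n).

Context {f : k.-tuple E -> R}.
Hypotheses (f_ge0 : forall x, 0 <= f x) (f_meas : measurable_fun [set: k.-tuple E] f).

Lemma integral_law n D : measurable D ->
  (\int[law n]_(x in D) (f x)%:E = \int[nu n]_(x in fc n @^-1` D) (f (fc n x))%:E)%E.
Proof.
move=> mD; rewrite ge0_integral_pushforward//.
  exact/measurable_funTS/measurable_EFinP.
by move=> x _; rewrite lee_fin.
Qed.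

Lemma integrable_law n : (law n).-integrable [set: k.-tuple E] (EFin \o f) <->
  (nu n).-integrable setT (fun x => (f (fc n x))%:E).
Proof.
have mfn : measurable_fun [set: trace_space (Om0 n)] (fun x => (f (fc n x))%:E).
  by apply/measurable_EFinP; apply: measurableT_comp => //; exact: measurable_first_coords.
have e : (\int[law n]_x `|(EFin \o f) x| = \int[nu n]_x `|(f (fc n x))%:E|)%E.
  under eq_integral do rewrite /= ger0_norm//.
  under [RHS]eq_integral do rewrite /= ger0_norm//.
  by rewrite integral_law// preimage_setT.
split=> /integrableP[m1 i1]; apply/integrableP; split => //.
- by rewrite -e.
- exact/measurable_EFinP.
- by rewrite e.
Qed.

Lemma integral_tail_fun n m :
  (\int[nu n]_x (tail_fun (n'k := n'k) f n m x)%:E = tail f (law n) m)%E.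
Proof.
rewrite /tail integral_law; last exact: measurable_gt.
rewrite [RHS]integral_mkcond; apply: eq_integral => x _.
rewrite /tail_fun patchE ger0_norm//; case: ifPn => h.
  by rewrite ifT// inE.
by rewrite ifF//; apply/negP; rewrite inE /=; exact/negP.
Qed.

Lemma integrable_tail_fun n m : (nu n).-integrable setT (fun x => (f (fc n x))%:E) ->
  (nu n).-integrable setT (EFin \o tail_fun (n'k := n'k) f n m).
Proof.
move=> int; apply: le_integrable int => //.
- apply/measurable_EFinP; apply: measurable_fun_ifT.
  + apply: measurable_fun_ltr => //; apply: measurableT_comp => //.
    by apply: measurableT_comp => //; exact: measurable_first_coords.
  + apply: measurableT_comp => //.
    by apply: measurableT_comp => //; exact: measurable_first_coords.
  + exact: measurable_cst.
- move=> x _; rewrite /= lee_fin /tail_fun; case: ifPn => _; first by rewrite normr_id.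
  by rewrite normr0.
Qed.

End law.

(** * The implications among (1), (2), (3) and uniform tails *)

Theorem theorem4p4 (R : realType) (d : measure_display) (E : measurableType d)
    (X Y : Type) (b : base_set R E X)
    (S : superstructure X) (S' : superstructure Y)
    (star : nonstandard_extension S S') (sat_star : aleph1_saturated star)
    (k : nat) (n' : above k -> nat) (n'k : forall n, (k < n' n)%N)
    (Om : forall n, set ((n' n).-tuple E)) (Om0 : forall n, Om n !=set0)
    (nu : forall n, probability (trace_space (Om0 n)) R)
    (P : probability (k.-tuple E) R)
    (nuP : forall (B : set (k.-tuple E)) (N : S'),
       measurable B -> hyper_infinite b star N ->
       loeb b star (star_Om b star Om0 N) (star_F b star Om0 N)
         (star_nu b star nu N) (star_cylinder b star n'k B N) (P B))
    (f : k.-tuple E -> R)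
    (f_ge0 : forall x, 0 <= f x) (f_meas : measurable_fun [set: k.-tuple E] f) :
  let f_ n (x : trace_space (Om0 n)) := (f (first_coords n'k x))%:E in
  let one := P.-integrable setT (EFin \o f) /\
    (\int[nu n]_x f_ n x)%E @[n --> above_oo k] --> (\int[P]_x (f x)%:E)%E in
  let two := forall N, hyper_infinite b star N ->
    S_integrable b star (star_Om b star Om0 N) (star_F b star Om0 N)
      (star_nu b star nu N) (star_fun b star n'k Om0 f N) in
  let three := (\forall n \near above_oo k, (nu n).-integrable setT (f_ n)) /\
    exists l : nat -> \bar R,
      (forall m : nat,
        (\int[nu n]_(x in [set x | (m%:R%:E <= f_ n x)%E]) f_ n x)%E
          @[n --> above_oo k] --> l m) /\
      l @ \oo --> 0%E in
  (one <-> two) /\ (two <-> three).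
Proof.
move=> f_ one two three.
pose Q : above k -> probability (k.-tuple E) R := law (n'k := n'k) (nu := nu).
have QP B : measurable B -> Q n B @[n --> above_oo k] --> P B.
  exact: (cvg_cylinder sat_star nuP).
pose UT := uniform_tails (above_oo k) Q f /\
  (\forall n \near above_oo k, (nu n).-integrable setT (f_ n)).
have EQ : (fun n => \int[nu n]_x f_ n x)%E = (fun n => \int[Q n]_x (f x)%:E)%E.
  by apply/funext => n; rewrite integral_law.
have EQm (m : nat) : (fun n => \int[nu n]_(x in [set x | (m%:R%:E <= f_ n x)%E]) f_ n x)%E
    = (fun n => \int[Q n]_(x in [set x | m%:R%:E <= (f x)%:E]) (f x)%:E)%E.
  by apply/funext => n; rewrite integral_law//; exact: measurable_ge.
have one_three : one -> three.
  move=> [Pf cf]; rewrite EQ in cf; split.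
    by apply: filterS (near_integrable f_ge0 f_meas cf Pf) => n /integrable_law; exact.
  exists (fun m : nat => \int[P]_(x in [set x | m%:R%:E <= (f x)%:E]) (f x)%:E)%E.
  split; last exact: cvg_integral_tail.
  by move=> m; rewrite EQm; apply: (cvg_integral_set QP) => //; exact: measurable_ge.
have three_UT : three -> UT.
  move=> [int [l [Ql l0]]]; split => //.
  by apply: (uniform_tailsI f_ge0 f_meas l _ l0) => m; have := Ql m; rewrite EQm.
have UT_one : UT -> one.
  by move=> [ut _]; rewrite /one EQ; exact: (uniform_tailsP QP).
have UT_two : UT -> two.
  move=> [ut /near_aboveP[n0 int]] N hN.
  have hN0 : hpt star (nat_code b S (k:=k)) [set n | (n0 <= sval n)%N] N.
    exact: hyper_infinite_idx.
  split; [| exact: (loeb_finite sat_star nuP) |].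
    have [h _] := star_integral hN0 (b := b) (nn := id) (fun n x => f (first_coords n'k x))
      (fun n hn => int n hn).
    eexists.
    (* [N] is read as the value at itself of the identity family, which brings the quadruple into
       the form of [space_code_ext]. *)
    rewrite star_fun_ext// -{1 2 3}(ext_id hN0).
    rewrite (space_code_ext hN0 (nn := id)); exact: h.
  move=> M hM e e0.
  (* Half of [e], because [infinitely_close] asks for a strict inequality. *)
  have [m1 /near_aboveP[n1 ut1]] := ut (e / 2) (divr_gt0 e0 (ltr0n _ 2)).
  (* [N] and [M] are unrelated, so the hyperpoint is their pair. On [A] the index is large enough
     for integrability and for the tail bound at [m1], and larger thresholds only shrink the
     tail. *)
  pose T := (above k * nat)%type.
  pose a (t : T) := opair (nat_code b S t.1) (nat_atom (b := b) (S := S) t.2).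
  pose A : set T := [set t | [/\ (maxn n0 n1 <= sval t.1)%N & (m1 <= t.2)%N]].
  have hN1 : hpt star (nat_code b S (k:=k)) [set n | (maxn n0 n1 <= sval n)%N] N.
    exact: hyper_infinite_idx.
  have hM1 := hyper_infinite_ge m1 hM.
  have hK : hpt star a A (opair N M).
    have [_ sn nN] := hN1; have [_ sm mM] := hM1; split.
    - by move=> [x y] [x' y'] /opair_inj[/idx_inj /= -> /nat_atom_inj ->].
    - by apply: small_opair; [exact: small_idx|exact: small_nat_atom].
    have := star_setX star _ _ _ _ (small_image _ _ sn) (small_image _ _ sm) nN mM.
    rewrite (_ : [set opair x y | x in _ & y in _] = a @` A)//.
    apply/seteqP; split=> [_ [_ [n nn <-]] [_ [m mm <-] <-]|_ [[n m] [/= nn mm] <-]].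
      by exists (n, m).
    by exists (nat_code b S n); [exists n|exists (nat_atom (b := b) (S := S) m) => //; exists m].
  have [EN EM] : ext star a (nat_code b S (k:=k) \o fst) (opair N M) = N /\
      ext star a (nat_atom (b := b) (S := S) \o snd) (opair N M) = M.
    have := ext_id hK; rewrite {1}/a (ext_opair hK (small_idx _) (small_nat_atom _)).
    by move=> /opair_inj.
  have hN' := hN; rewrite -EN in hN'.
  have tailE := star_tail_ext hK f hN' (mm := snd); rewrite EN EM in tailE.
  have intA t : A t -> (nu t.1).-integrable setT (EFin \o tail_fun (n'k := n'k) f t.1 t.2).
    move=> [/= n0n _]; apply: integrable_tail_fun => //; apply: int.
    by apply: leq_trans n0n; rewrite leq_maxl.
  have [_ intE] := star_integral hK (b := b) (nn := fst) _ intA.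
  have := space_code_ext hK (b := b) (nu := nu) (nn := fst)
    (fun t => tail_fun (n'k := n'k) f t.1 t.2).
  rewrite EN tailE => ->; rewrite intE.
  apply/(star_real_ext _ _ hK).
  apply: hpt_sub hK => t [nt mt]; split => //=; rewrite subr0.
  rewrite integral_tail_fun//.
  have tle : (tail f (Q t.1) t.2 <= (e / 2)%:E)%E.
    apply: le_trans (tail_antitone f_ge0 f_meas _ _ _ mt) _; apply: ut1.
    by apply: leq_trans nt; rewrite leq_maxr.
  have t0 : (0 <= tail f (Q t.1) t.2)%E by apply: integral_ge0 => x _; rewrite lee_fin.
  move: t0 tle; rewrite -/(Q t.1); case: (tail f (Q t.1) t.2) => //= r.
  rewrite !lee_fin => r0 re; rewrite ger0_norm//; lra.
have two_UT : two -> UT.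
  move=> h2; have [K hK] := hyper_infinite_exists (b := b) sat_star.
  have [hK' _] := (hyper_infiniteP _).1 hK.
  (* Otherwise non-integrability along a sequence would put the space at an infinite index outside
     the domain of the internal integral. *)
  have int : \forall n \near above_oo k, (nu n).-integrable setT (f_ n).
    apply: contrapT => /(not_near_above _ 0)[g gP].
    have hN : hyper_infinite b star (ext star (nat_atom (b := b)) (nat_code b S (k:=k) \o g) K).
      by apply: hyper_infinite_sub => // j; have [] := gP j; rewrite max0n.
    have [[y hy] _ _] := h2 _ hN; move: hy.
    rewrite star_fun_ext// (ext_comp hK').
    - rewrite (space_code_ext hK' (nn := g)).
      by apply: (star_nonintegrable hK') => j _; have [] := gP j.
    - exact: idx_inj.
    - exact: (small_idx id).
    - by apply/small_famP; exists 3%N => t; exact: code_fun_lev.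
  split => //; have /near_aboveP[n0 int0] := int.
  move=> e e0; apply: contrapT => ne.
  (* The threshold [m] is also a lower bound for the index. At [K] the threshold becomes [K] and the
     index the value of the sequence, both infinite, while the tail still exceeds [e]. *)
  have {}ne (m : nat) : exists n : above k,
      (maxn n0 m <= sval n)%N /\ (e%:E < tail f (Q n) m)%E.
    have nem : ~ \forall n \near above_oo k, (tail f (Q n) m <= e%:E)%E.
      by move=> h; apply: ne; exists m.
    have [g gP] := not_near_above _ n0 nem; have [g1 g2] := gP m.
    by exists (g m); split => //; rewrite ltNge; apply/negP.
  have gex (m : nat) : {n : above k | (maxn n0 m <= sval n)%N /\ (e%:E < tail f (Q n) m)%E}.
    exact: cid.
  pose g m := sval (gex m).
  have gn m : (maxn n0 m <= sval (g m))%N by have [] := svalP (gex m).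
  have gt m : (e%:E < tail f (Q (g m)) m)%E by have [] := svalP (gex m).
  have hN : hyper_infinite b star (ext star (nat_atom (b := b)) (nat_code b S (k:=k) \o g) K).
    by apply: hyper_infinite_sub => // j; apply: leq_trans (gn j); rewrite leq_maxr.
  have [_ _ /(_ K hK e e0)] := h2 _ hN.
  have KE : ext star (nat_atom (b := b)) (nat_atom (b := b) (S := S) \o id) K = K := ext_id hK'.
  have := star_tail_ext hK' f hN (mm := id); rewrite KE => ->.
  have intA j : [set: nat] j ->
      (nu (g j)).-integrable setT (EFin \o tail_fun (n'k := n'k) f (g j) j).
    move=> _; apply: integrable_tail_fun => //; apply: int0.
    by apply: leq_trans (gn j); rewrite leq_maxl.
  rewrite (space_code_ext hK' (nn := g)).
  have [_ ->] := star_integral hK' (b := b) (nn := g) _ intA.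
  rewrite (star_real_ext [set r | `|r - 0| < e] _ hK').
  rewrite (_ : _ `&` _ = set0); first exact: hpt0.
  apply/seteqP; split=> // j [_ /=]; rewrite subr0 integral_tail_fun//.
  have := gt j; have : tail f (Q (g j)) j \is a fin_num.
    by rewrite -integral_tail_fun//; apply: integrable_fin_num => //; exact: intA.
  move=> /fineK <-; rewrite lte_fin -/(Q (g j)) => h1 h2'.
  by have := le_lt_trans (ler_norm _) h2'; rewrite ltNge (ltW h1).
by split; split; tauto.
Qed.
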